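(* If $A$ is a $C^*$-algebra, then $Z(A)+J_{wc}(A)\subseteq\mathrm{CQ}(A)$.
   Context: $A$ is not assumed unital. ''Ideal'' means closed two-sided ideal; $Z(A)$ is the centre of $A$. An element $a\in A$ is a CQ-element of $A$ if for every ideal $I$ of $A$, $a+I\in Z(A/I)$ implies $a\in Z(A)+I$; $\mathrm{CQ}(A)$ is the set of all CQ-elements of $A$. An ideal $I$ is modular if $A/I$ is unital; $\mathrm{Max}(A)$ is the set of all modular maximal (proper) ideals of $A$. $A$ is weakly central if (a) no $M\in\mathrm{Max}(A)$ contains $Z(A)$, and (b) for all $M_1,M_2\in\mathrm{Max}(A)$, $M_1\cap Z(A)=M_2\cap Z(A)$ implies $M_1=M_2$. An ideal is weakly central if it is so as a $C^*$-algebra. $J_{wc}(A)$ denotes the largest weakly central ideal of $A$; it exists and equals $\ker T_A$, the intersection of all elements of $T_A$ (with $\ker\emptyset=A$), where $T_A$ is the set of all $M\in\mathrm{Max}(A)$ such that either $Z(A)\subseteq M$, or $Z(A)\nsubseteq M$ and there is $N\in\mathrm{Max}(A)$ with $N\neq M$, $Z(A)\nsubseteq N$ and $M\cap Z(A)=N\cap Z(A)$. *)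

(* Defs.v *)
From HB Require Import structures.
From mathcomp Require Import all_boot all_order all_algebra complex.
From mathcomp Require Import all_classical all_reals all_analysis.
Import Order.TTheory GRing.Theory Num.Theory.
Import numFieldNormedType.Exports.

Set Implicit Arguments.
Unset Strict Implicit.
Unset Printing Implicit Defensive.

Local Open Scope classical_set_scope.
Local Open Scope ring_scope.
Local Open Scope complex_scope.

(* A C*-algebra is a complex Banach space with an associative bilinear product
   (no unit is required), a conjugate-linear anti-multiplicative involution,
   a submultiplicative norm and the C*-identity.  MathComp-Analysis norms over
   R[i] take their values in R[i], whose order restricts to that of R. *)
HB.mixin Record CompleteNormedModule_isCStarAlgebra (R : realType) A
    of CompleteNormedModule R[i] A := {
  cmul : A -> A -> A;
  cstar : A -> A;
  cmulA : associative cmul;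
  cmulDl : left_distributive cmul +%R;
  cmulDr : right_distributive cmul +%R;
  cmulZl : forall (c : R[i]) (x y : A), cmul (c *: x) y = c *: cmul x y;
  cmulZr : forall (c : R[i]) (x y : A), cmul x (c *: y) = c *: cmul x y;
  cstarD : forall x y : A, cstar (x + y) = cstar x + cstar y;
  cstarZ : forall (c : R[i]) (x : A), cstar (c *: x) = Num.conj c *: cstar x;
  cstarK : involutive cstar;
  cstarM : forall x y : A, cstar (cmul x y) = cmul (cstar y) (cstar x);
  cnormM_le : forall x y : A, `|cmul x y| <= `|x| * `|y|;
  cnorm_star : forall x : A, `|cmul (cstar x) x| = `|x| ^+ 2
}.

#[short(type="cstarAlgType")]
HB.structure Definition CStarAlgebra (R : realType) :=
  { A of CompleteNormedModule_isCStarAlgebra R A & CompleteNormedModule R[i] A }.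

Notation "x ** y" := (cmul x y) (at level 40, left associativity) : ring_scope.

(* The notions below are defined for a C*-algebra B sitting as a closed subset
   of an ambient C*-algebra A.  They are only used with B = [set: A] and with B
   a closed two-sided ideal of A regarded as a C*-algebra.  They involve only
   the product, the linear structure and the topology, all inherited from A. *)
Section CStarNotions.
Context {R : realType} {A : cstarAlgType R}.
Implicit Types (B I J K M X Y E : set A) (a b : A).

Definition centre B : set A :=
  [set z | B z /\ forall b, B b -> z ** b = b ** z].

(* As B is closed in A, closedness of I in B is closedness of I in A. *)
Definition is_ideal B I : Prop :=
  [/\ I `<=` B, submod_closed [in I], closed I &
      forall b x, B b -> I x -> I (b ** x) /\ I (x ** b)].

(* The coset a + I. *)
Definition coset I a : set A := [set b | I (b - a)].

(* The quotient B / I, as a set of cosets. *)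
Definition quot B I : set (set A) := coset I @` B.

(* The product of B / I: (a + I)(b + I) = ab + I. *)
Definition quot_mul I X Y : set A :=
  [set c | exists x y, [/\ X x, Y y & coset I (x ** y) c]].

Definition quot_centre B I : set (set A) :=
  [set X | quot B I X /\
           forall Y, quot B I Y -> quot_mul I X Y = quot_mul I Y X].

(* The CQ-elements: a + I is in Z(B / I) only if a is in Z(B) + I. *)
Definition CQ B : set A :=
  [set a | B a /\
     forall I, is_ideal B I -> quot_centre B I (coset I a) ->
       [set z + i | z in centre B & i in I] a].

(* The quotient B / I is unital. *)
Definition modular B I : Prop :=
  exists2 E, quot B I E &
    forall X, quot B I X -> quot_mul I E X = X /\ quot_mul I X E = X.

Definition Max B : set (set A) :=
  [set M | [/\ is_ideal B M, modular B M, M <> B &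
     forall K, is_ideal B K -> M `<=` K -> K = M \/ K = B]].

Definition weakly_central B : Prop :=
  (forall M, Max B M -> ~ (centre B `<=` M)) /\
  (forall M1 M2, Max B M1 -> Max B M2 ->
     M1 `&` centre B = M2 `&` centre B -> M1 = M2).

Definition weakly_central_ideal J : Prop :=
  is_ideal [set: A] J /\ weakly_central J.

(* J is J_wc(A), the largest weakly central ideal of A. *)
Definition is_Jwc J : Prop :=
  weakly_central_ideal J /\
  forall K, weakly_central_ideal K -> K `<=` J.

End CStarNotions.

(* Main.v *)
(* A counterexample [c] to [c \in Z(B) + K], for [B] weakly central and [c]
   central modulo the ideal [K], is localised by Zorn's lemma at an ideal [I]
   maximal among those at distance at least [e] from all [c - z], with [z] central
   of norm at most [2 |c|].  If [I] lay in two maximal ideals, weak centrality would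
   give a central unitary [V] separating them; then every ideal generated by [I] and
   [V - zeta], with [|zeta| = 1], is larger than [I], so that [c] can be
   approximated there, and a Fejer partition of unity evaluated at [V] glues these
   approximations without loss in the error, a contradiction.  So [I] lies in at
   most one maximal ideal [M]; there [c] is a scalar, attained by a central [z],
   and [c - z] belongs to [I] because an element central modulo [I] and outside [I]
   avoids some maximal ideal containing [I]; this last fact is the same gluing
   argument with [z = 0].  The bound on [z] makes the approximations summable, which
   yields an exact lift.
   All norm estimates come from one von Neumann inequality: a polynomial in a
   central unitary, with coefficients in the algebra, is bounded by the supremum of
   its values at scalars on the unit circle. *)
Require Import Defs.
From HB Require Import structures.
From mathcomp Require Import all_boot all_order all_algebra complex.
From mathcomp Require Import all_classical all_reals all_analysis.
From mathcomp Require Import ring lra.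
Import Order.TTheory GRing.Theory Num.Theory.
Import numFieldNormedType.Exports.

Set Implicit Arguments.
Unset Strict Implicit.
Unset Printing Implicit Defensive.

Local Open Scope classical_set_scope.
Local Open Scope ring_scope.

(** * Real-valued norms *)

(** The theorem reduces to this lifting with [B] the ideal [J]: if [z + j] is central modulo [I], so
    is [j], and as [J] is an ideal, [j] is even central modulo the intersection of [I] and [J]. A
    lift of [j] to the centre of [J] is central in [A], because a central element of an ideal
    commutes with the whole algebra. The missing unit shapes the tools, and no functional calculus
    or Gelfand theory is used. A self-adjoint element is scaled into the unit ball and replaced by
    its Cayley transform, a unitary of the unitisation given by a Neumann series and lying in the
    same ideals. Cesaro means of the powers of this unitary act as an approximate unit; from them
    come the self-adjointness of closed ideals, the fact that an ideal of an ideal is an ideal, and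
    the C*-identity in quotients. Norms in a quotient are handled as distances to the ideal. *)

Definition nrm (R : realType) (V : normedZmodType R[i]) (x : V) : R :=
  complex.Re `|x|.

Section Norm.
Context {R : realType} {V : normedZmodType R[i]}.
Implicit Types x y : V.

Lemma nrmE x : `|x| = (nrm x)%:C%C.
Proof. by rewrite /nrm RRe_real // normr_real. Qed.

Lemma nrm_ge0 x : 0 <= nrm x.
Proof. by rewrite -ler0c -nrmE. Qed.

Lemma nrmD x y : nrm (x + y) <= nrm x + nrm y.
Proof. by rewrite -lecR rmorphD/= -!nrmE ler_normD. Qed.

Lemma nrmN x : nrm (- x) = nrm x.
Proof. by rewrite /nrm normrN. Qed.

Lemma nrmB x y : nrm (x - y) <= nrm x + nrm y.
Proof. by rewrite -(nrmN y) nrmD. Qed.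

Lemma nrm0 : nrm (0 : V) = 0.
Proof. by rewrite /nrm normr0. Qed.

Lemma nrm0_eq0 x : nrm x = 0 -> x = 0.
Proof. by move=> x0; apply/eqP; rewrite -normr_eq0 nrmE x0. Qed.

Lemma nrm_sum (I : Type) (r : seq I) (P : pred I) (F : I -> V) :
  nrm (\sum_(i <- r | P i) F i) <= \sum_(i <- r | P i) nrm (F i).
Proof.
elim/big_ind2 : _ => [|x a y b xa yb|i _]; rewrite ?nrm0 //.
by rewrite (le_trans (nrmD _ _))// lerD.
Qed.

End Norm.

Section Cabs.
Context {R : realType}.
Implicit Types c d : R[i].

Lemma cabsM c d : nrm (c * d) = nrm c * nrm d.
Proof. by apply: (@complexI R); rewrite rmorphM/= -!nrmE normrM. Qed.

Lemma cabs1 : nrm (1 : R[i]) = 1.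
Proof. by rewrite /nrm normr1. Qed.

Lemma cabs_sqr c : c * Num.conj c = (nrm c ^+ 2)%:C%C.
Proof. by rewrite -normCK nrmE rmorphXn. Qed.

Lemma cabs_real (a : R) : nrm (a%:C%C) = `|a|.
Proof. by rewrite /nrm normc_def/= expr0n/= addr0 sqrtr_sqr. Qed.

Lemma cabsX c n : nrm (c ^+ n) = nrm c ^+ n.
Proof. by elim: n => [|n IH]; rewrite ?expr0 ?cabs1// !exprS cabsM IH. Qed.

Lemma cabsV c : nrm (c^-1) = (nrm c)^-1.
Proof.
have [->|c0] := eqVneq c 0; first by rewrite !(invr0, nrm0).
have n0 : nrm c != 0 by apply: contra_neq c0 => /nrm0_eq0.
by apply: (mulfI n0); rewrite -cabsM !mulfV// cabs1.
Qed.

Lemma cabs_i : nrm ('i%C : R[i]) = 1.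
Proof.
by rewrite /nrm normc_def/= expr0n/= add0r expr1n sqrtr1.
Qed.

End Cabs.

Definition adherent (R : realType) (V : normedZmodType R[i]) (S : set V) (x : V) :=
  forall e : R, 0 < e -> exists2 y, S y & nrm (x - y) < e.

(** * Elementary calculus in a C*-algebra *)

Section CStarBasics.
Context {R : realType} {A : cstarAlgType R}.
Implicit Types (x y z : A) (c : R[i]) (S : set A).

Lemma nrmZ c x : nrm (c *: x) = nrm c * nrm x.
Proof. by apply: (@complexI R); rewrite rmorphM/= -!nrmE normrZ. Qed.

Lemma nrmM x y : nrm (x ** y) <= nrm x * nrm y.
Proof. by rewrite -lecR rmorphM/= -!nrmE cnormM_le. Qed.

Lemma nrm_sqr x : nrm (cstar x ** x) = nrm x ^+ 2.
Proof. by apply: (@complexI R); rewrite rmorphXn/= -!nrmE cnorm_star. Qed.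

Lemma nrm_star x : nrm (cstar x) = nrm x.
Proof.
suff H y : nrm y <= nrm (cstar y).
  by apply/eqP; rewrite eq_le H -{2}(cstarK x) H.
have := nrmM (cstar y) y; rewrite nrm_sqr expr2.
have := nrm_ge0 y; rewrite le0r => /predU1P[-> _|y0]; first exact: nrm_ge0.
by rewrite ler_pM2r.
Qed.

Lemma nrm_sqr' x : nrm (x ** cstar x) = nrm x ^+ 2.
Proof. by rewrite -{1}(cstarK x) nrm_sqr nrm_star. Qed.

Lemma cmul0l x : 0 ** x = 0.
Proof. by apply: (addrI (0 ** x)); rewrite -cmulDl !addr0. Qed.

Lemma cmul0r x : x ** 0 = 0.
Proof. by apply: (addrI (x ** 0)); rewrite -cmulDr !addr0. Qed.

Lemma cmulNl x y : (- x) ** y = - (x ** y).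
Proof. by apply: (addrI (x ** y)); rewrite -cmulDl !subrr cmul0l. Qed.

Lemma cmulNr x y : x ** (- y) = - (x ** y).
Proof. by apply: (addrI (x ** y)); rewrite -cmulDr !subrr cmul0r. Qed.

Lemma cmulBl x y z : (x - y) ** z = x ** z - y ** z.
Proof. by rewrite cmulDl cmulNl. Qed.

Lemma cmulBr x y z : z ** (x - y) = z ** x - z ** y.
Proof. by rewrite cmulDr cmulNr. Qed.

Lemma cmul_suml (I : Type) (r : seq I) (P : pred I) (F : I -> A) x :
  (\sum_(i <- r | P i) F i) ** x = \sum_(i <- r | P i) F i ** x.
Proof.
by elim/big_ind2 : _ => [|a b a' b' <- <-|]; rewrite ?cmul0l ?cmulDl.
Qed.

Lemma cmul_sumr (I : Type) (r : seq I) (P : pred I) (F : I -> A) x :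
  x ** (\sum_(i <- r | P i) F i) = \sum_(i <- r | P i) x ** F i.
Proof.
by elim/big_ind2 : _ => [|a b a' b' <- <-|]; rewrite ?cmul0r ?cmulDr.
Qed.

Lemma cstar0 : cstar 0 = 0 :> A.
Proof. by apply: (addrI (cstar 0)); rewrite -cstarD !addr0. Qed.

Lemma cstarN x : cstar (- x) = - cstar x.
Proof. by apply: (addrI (cstar x)); rewrite -cstarD !subrr cstar0. Qed.

Lemma cstarB x y : cstar (x - y) = cstar x - cstar y.
Proof. by rewrite cstarD cstarN. Qed.

Lemma cstar_sum (I : Type) (r : seq I) (P : pred I) (F : I -> A) :
  cstar (\sum_(i <- r | P i) F i) = \sum_(i <- r | P i) cstar (F i).
Proof.
by elim/big_ind2 : _ => [|a b a' b' <- <-|]; rewrite ?cstar0 ?cstarD.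
Qed.

Lemma closed_adherent S : closed S <-> (forall x, adherent S x -> S x).
Proof.
have E (e : R[i]) : 0 < e -> exists2 r : R, 0 < r & e = (r%:C)%C.
  move=> e0; exists (complex.Re e); last by rewrite RRe_real// gtr0_real.
  by rewrite -ltcR RRe_real// gtr0_real.
have ballE x (e : R) y : ball x (e%:C)%C y <-> nrm (x - y) < e.
  by rewrite -ball_normE /= nrmE ltcR.
split=> [cS x Sx|HS].
  apply: cS => U /nbhs_ballP[e e0 eU].
  have [r r0 er] := E _ e0.
  have [y Sy xy] := Sx _ r0; exists y; split=> //; apply: eU.
  by rewrite er; apply/ballE.
move=> x Sx; apply: HS => e e0.
have [|y [Sy /ballE]] := Sx (ball x (e%:C)%C); last by exists y.
by apply: nbhsx_ballx; rewrite ltcR.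
Qed.

Lemma cauchy_geometric (u : nat -> A) (C r : R) : 0 <= r < 1 ->
  (forall n, nrm (u n.+1 - u n) <= C * r ^+ n) ->
  exists l, forall e : R, 0 < e -> exists N, forall n, (N <= n)%N -> nrm (l - u n) < e.
Proof.
move=> /andP[r0 r1] uC; pose D := C / (1 - r).
have r1' : 1 - r != 0 by rewrite subr_eq0 gt_eqF.
(* Keeping the difference of powers, instead of bounding it by [r ^+ n], turns the induction step
   into an identity. *)
have tail n k : nrm (u (n + k)%N - u n) <= D * (r ^+ n - r ^+ (n + k)).
  elim: k => [|k IH]; first by rewrite addn0 !subrr nrm0 mulr0.
  rewrite addnS -(subrK (u (n + k)%N) (u _.+1)) -addrA.
  rewrite (le_trans (nrmD _ _))// (le_trans (lerD (uC _) IH))//.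
  by rewrite le_eqVlt; apply/orP; left; apply/eqP; rewrite /D exprS; field.
have D0 : 0 <= D.
  have := le_trans (nrm_ge0 _) (uC 0%N); rewrite expr0 mulr1 => C0.
  by rewrite divr_ge0// subr_ge0 ltW.
have small e : 0 < e -> exists N, D * r ^+ N < e.
  move=> e0; have D1 : 0 < D + 1 by lra.
  have /cvgrPdist_lt /(_ (e / (D + 1))) : r ^+ n @[n --> \oo] --> (0 : R).
    by apply: cvg_expr; rewrite ger0_norm.
  case; first by rewrite divr_gt0.
  move=> N _ /(_ N (leqnn _))/=; rewrite sub0r normrN ger0_norm ?exprn_ge0//.
  rewrite ltr_pdivlMr// => H; exists N; apply: le_lt_trans H.
  by rewrite mulrC ler_wpM2l ?exprn_ge0// lerDl.
have dist N n : (N <= n)%N -> nrm (u N - u n) <= D * r ^+ N.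
  move=> /subnKC <-; rewrite -opprB nrmN (le_trans (tail _ _))// ler_wpM2l//.
  by rewrite gerBl exprn_ge0.
have toR (e : R[i]) : 0 < e -> exists2 t : R, 0 < t & e = (t%:C)%C.
  move=> e0; exists (complex.Re e); last by rewrite RRe_real// gtr0_real.
  by rewrite -ltcR RRe_real// gtr0_real.
have : cvg (u @ \oo).
  apply: cauchy_cvg; apply: cauchy_exP => e e0.
  have [t t0 et] := toR _ e0; have [N HN] := small _ t0.
  exists (u N); exists N => // n /= Nn.
  by rewrite -ball_normE /= nrmE et ltcR (le_lt_trans (dist _ _ Nn)).
move=> /cvg_ex[l /cvgrPdist_lt ul]; exists l => e e0.
have [|N _ HN] := ul ((e%:C)%C); first by rewrite ltcR.
by exists N => n /HN /=; rewrite nrmE ltcR.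
Qed.

End CStarBasics.

(** * Linear identities *)

(* Reflexive decision of the linear identities of a module: the two sides are
   compared coefficientwise by [ring]. *)
Inductive lexpr (K : Type) :=
  LVar of nat | LZero | LAdd of lexpr K & lexpr K | LOpp of lexpr K
| LScale of K & lexpr K.
Arguments LVar {K}.
Arguments LZero {K}.

Section LinearIdentities.
Context {K : comNzRingType} {V : lmodType K}.

Fixpoint leval (s : seq V) (e : lexpr K) : V :=
  match e with
  | LVar n => nth 0 s n
  | LZero => 0
  | LAdd e f => leval s e + leval s f
  | LOpp e => - leval s e
  | LScale c e => c *: leval s e
  end.

Fixpoint lcoef (n : nat) (e : lexpr K) : K :=
  match e with
  | LVar m => if Nat.eqb m n then 1 else 0
  | LZero => 0
  | LAdd e f => lcoef n e + lcoef n f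
  | LOpp e => - lcoef n e
  | LScale c e => c * lcoef n e
  end.

Fixpoint lsame (n : nat) (e f : lexpr K) : Prop :=
  if n is m.+1 then lcoef m e = lcoef m f /\ lsame m e f else True.

Lemma leval_coef s e : leval s e = \sum_(n < size s) lcoef n e *: nth 0 s n.
Proof.
elim: e => /= [m||e -> f ->|e ->|c e ->].
- have -> : \sum_(n < size s) (if Nat.eqb m n then 1 else 0) *: s`_n =
            \sum_(n < size s | (n : nat) == m) s`_n.
    rewrite [RHS]big_mkcond/=; apply: eq_bigr => n _.
    have -> : Nat.eqb m n = (n == m :> nat).
      by apply/idP/eqP => [/PeanoNat.Nat.eqb_eq //|->]; rewrite PeanoNat.Nat.eqb_refl.
    by case: eqP => _; rewrite ?scale1r ?scale0r.
  have [ms|ms] := ltnP m (size s); first by rewrite (big_pred1 (Ordinal ms)).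
  rewrite big1 ?nth_default// => n /eqP nm.
  by have := ltn_ord n; rewrite nm ltnNge ms.
- by rewrite big1// => n _; rewrite scale0r.
- by rewrite -big_split/=; apply: eq_bigr => n _; rewrite scalerDl.
- by rewrite -sumrN; apply: eq_bigr => n _; rewrite scaleNr.
- by rewrite scaler_sumr; apply: eq_bigr => n _; rewrite scalerA.
Qed.

Lemma lsameP s e f : lsame (size s) e f -> leval s e = leval s f.
Proof.
move=> H; rewrite !leval_coef; apply: eq_bigr => -[n ns] _ /=; congr (_ *: _).
by move: H ns; elim: (size s) => // m IH /= [em H]; rewrite ltnS leq_eqVlt => /predU1P[->//|/IH]; apply.
Qed.

End LinearIdentities.

Ltac lmod_insert x s :=
  match s with
  | nil => constr:(x :: nil)
  | x :: _ => s
  | ?y :: ?t => let t' := lmod_insert x t in constr:(y :: t')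
  end.

Ltac lmod_vars e s :=
  match e with
  | @GRing.add _ ?x ?y => let s' := lmod_vars x s in lmod_vars y s'
  | @GRing.opp _ ?x => lmod_vars x s
  | @GRing.scale _ _ _ ?x => lmod_vars x s
  | @GRing.zero _ => s
  | _ => lmod_insert e s
  end.

Ltac lmod_index x s :=
  match s with
  | x :: _ => constr:(0%N)
  | _ :: ?t => let n := lmod_index x t in constr:(S n)
  end.

Ltac lmod_reify K e s :=
  match e with
  | @GRing.add _ ?x ?y =>
      let a := lmod_reify K x s in let b := lmod_reify K y s in
      constr:(@LAdd K a b)
  | @GRing.opp _ ?x => let a := lmod_reify K x s in constr:(@LOpp K a)
  | @GRing.scale _ _ ?c ?x =>
      let a := lmod_reify K x s in constr:(@LScale K c a)
  | @GRing.zero _ => constr:(@LZero K)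
  | _ => let n := lmod_index e s in constr:(@LVar K n)
  end.

Ltac lmod K :=
  match goal with
  | |- @eq ?V ?x ?y =>
      let s0 := lmod_vars x (@nil V) in let s := lmod_vars y s0 in
      let a := lmod_reify K x s in let b := lmod_reify K y s in
      apply: (@lsameP _ _ s a b);
      cbn [lsame lcoef size Nat.eqb]; repeat split; ring
  end.

(** * Unitaries and their Cesaro means *)

Section Unitaries.
Context {R : realType} {A : cstarAlgType R}.
Implicit Types (x y z v k : A) (c : R[i]) (S I B : set A).

Definition subspace S := [/\ S 0, forall x y, S x -> S y -> S (x + y)
  & forall c x, S x -> S (c *: x)].

Lemma submod_closedP S : submod_closed [in S] <-> subspace S.
Proof.
split=> [[S0 Sl]|[S0 SD SZ]].
  have S0' : S 0 by move: S0; rewrite inE.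
  have H c x y : S x -> S y -> S (c *: x + y).
    by move=> Sx Sy; have := Sl c x y; rewrite !inE; apply.
  by split=> // [x y Sx Sy|c x Sx]; [rewrite -(scale1r x)|rewrite -(addr0 (_ *: _))]; apply: H.
split; first by rewrite inE.
by move=> c x y; rewrite !inE => Sx Sy; apply: SD => //; apply: SZ.
Qed.

Lemma subspaceN S x : subspace S -> S x -> S (- x).
Proof. by move=> [_ _ SZ] Sx; rewrite -scaleN1r; apply: SZ. Qed.

Lemma subspaceB S x y : subspace S -> S x -> S y -> S (x - y).
Proof.
by move=> SS Sx Sy; have [_ SD _] := SS; apply: SD => //; apply: subspaceN.
Qed.

Lemma subspace_sum S (I : Type) (r : seq I) (P : pred I) (F : I -> A) :
  subspace S -> (forall i, P i -> S (F i)) -> S (\sum_(i <- r | P i) F i).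
Proof. by move=> [S0 SD _] SF; elim/big_ind : _. Qed.

Definition closed_subalgebra S :=
  [/\ subspace S, closed S & forall x y, S x -> S y -> S (x ** y)].

(* [A] has no unit: [unitary v] says that [1 + v] is unitary in the
   unitisation, and [act v] is the multiplication by [1 + v]. *)
Definition unitary v :=
  v + cstar v + v ** cstar v = 0 /\ v + cstar v + cstar v ** v = 0.

Definition act v x := x + v ** x.

(** [g] is the sum of the powers of [k] from degree one on, so that [1 + g] is the inverse of
    [1 - k] in the unitisation. The partial sums are polynomials in [k] without constant term, hence
    the last clause. *)
Lemma quasi_inverse k : nrm k < 1 ->
  exists g, [/\ g = k + k ** g, g = k + g ** k &
    forall S, closed_subalgebra S -> S k -> S g].
Proof.
move=> k1; pose u n := iter n (fun x => k + k ** x) 0.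
have uS n : u n.+1 = k + k ** u n by [].
have [|n|g ug] := @cauchy_geometric _ _ u (nrm k) (nrm k).
- by rewrite nrm_ge0.
- elim: n => [|n IH]; first by rewrite /u/= cmul0r addr0 subr0 expr0 mulr1.
  rewrite uS [u n.+1]uS opprD addrACA subrr add0r -cmulBr (le_trans (nrmM _ _))//.
  by rewrite exprS ler_wpM2l ?nrm_ge0.
have fix_unique x y : x = k + k ** x -> y = k + k ** y -> x = y.
  move=> ex ey; apply/eqP; rewrite -subr_eq0; apply/eqP/nrm0_eq0.
  have : nrm (x - y) <= nrm k * nrm (x - y).
    by rewrite {1}ex {1}ey opprD addrACA subrr add0r -cmulBr nrmM.
  have := nrm_ge0 (x - y); have := nrm_ge0 k; nra.
have eg : g = k + k ** g.
  apply/eqP; rewrite -subr_eq0; apply/eqP/nrm0_eq0/eqP.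
  rewrite eq_le nrm_ge0 andbT; apply/ler_addgt0Pl => e e0; rewrite addr0.
  have [|N HN] := ug (e / 2); first by rewrite divr_gt0.
  have -> : g - (k + k ** g) = (g - u N.+1) - k ** (g - u N).
    by rewrite uS cmulBr; lmod R[i].
  rewrite (le_trans (nrmB _ _))//.
  have := HN N (leqnn _); have := HN N.+1 (leqnSn _).
  have := nrmM k (g - u N); have := nrm_ge0 (g - u N); have := nrm_ge0 k.
  nra.
(* [k + g ** k] solves the same fixed point equation as [g], and the solution is unique since [k]
   has norm below one. *)
have eg' : g = k + g ** k.
  apply: fix_unique => //.
  by rewrite cmulDr cmulA -cmulDl -eg.
exists g; split=> // S [[S0 SD SZ] cS SM] Sk.
have Su n : S (u n) by elim: n => [//|n IH]; rewrite uS; apply: SD => //; apply: SM.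
apply/(iffLR (closed_adherent S)) => // e /ug[N HN].
by exists (u N) => //; apply: HN.
Qed.

(** With [1 + g] the inverse of [1 - ik], [v = 2g] gives [1 + v = (1 + ik) / (1 - ik)], unitary as
    [k] is self-adjoint. The two equations say that [1 - ik] times [1 + v], in either order, is
    [1 + ik]. *)
Lemma cayley k : cstar k = k -> nrm k < 1 ->
  exists v, [/\ unitary v, v = (2 * 'i%C) *: k + 'i%C *: (k ** v),
    v = (2 * 'i%C) *: k + 'i%C *: (v ** k) &
    forall S, closed_subalgebra S -> S k -> S v].
Proof.
move=> ks k1.
have [|g [eg eg' Sg]] := @quasi_inverse ('i%C *: k).
  by rewrite nrmZ cabs_i mul1r.
have conj_i : Num.conj 'i%C = - 'i%C :> R[i] by rewrite complexiE conjCi.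
have gs : cstar g = - ('i%C *: k) - 'i%C *: (k ** cstar g).
  rewrite [LHS](congr1 cstar eg') cstarD cstarM !cstarZ ks conj_i.
  by rewrite cmulZl !scaleNr.
have gs' : cstar g = - ('i%C *: k) - 'i%C *: (cstar g ** k).
  rewrite [LHS](congr1 cstar eg) cstarD cstarM !cstarZ ks conj_i.
  by rewrite cmulZr !scaleNr.
exists (2 *: g); split.
- have two : Num.conj (2 : R[i]) = 2 by rewrite conjC_nat.
  split; rewrite cstarZ two cmulZl cmulZr.
    (* Unitarity of [1 + 2g] means that twice this product is [- g - cstar g]. With the product on
       both sides, the identity follows by expanding one factor [g] once. *)
    have : g ** cstar g = - cstar g - g - g ** cstar g; last first.
      set h := g ** _ => e; have -> : 2 *: (2 *: h) = (2 : R[i]) *: (h + h) by lmod R[i].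
      by rewrite {1}e; lmod R[i].
    rewrite {1}eg' cmulDl -cmulA cmulZl.
    have -> : 'i%C *: (k ** cstar g) = - ('i%C *: k) - cstar g.
      by rewrite {2}gs; lmod R[i].
    rewrite cmulBr cmulNr cmulZr.
    have -> : 'i%C *: (g ** k) = g - 'i%C *: k.
      by move: eg'; rewrite cmulZr => {2}->; lmod R[i].
    by lmod R[i].
  have : cstar g ** g = - cstar g - g - cstar g ** g; last first.
    set h := _ ** g => e; have -> : 2 *: (2 *: h) = (2 : R[i]) *: (h + h) by lmod R[i].
    by rewrite {1}e; lmod R[i].
  have e1 : 'i%C *: (k ** g) = g - 'i%C *: k.
    by move: eg; rewrite cmulZl => {2}->; lmod R[i].
  have e2 : 'i%C *: (cstar g ** k) = - ('i%C *: k) - cstar g.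
    by rewrite {2}gs'; lmod R[i].
  rewrite {1}gs' cmulBl cmulNl !cmulZl e1 -cmulA.
  rewrite -cmulZr e1 cmulBr cmulZr e2; lmod R[i].
- by rewrite {1}eg cmulZr cmulZl; lmod R[i].
- by rewrite {1}eg' cmulZr cmulZl; lmod R[i].
- move=> S SS Sk; have [[_ _ SZ] _ _] := SS; apply: (SZ); apply: Sg => //.
  exact: SZ.
Qed.

Section Act.
Variable v : A.
Implicit Types n m : nat.
Local Notation T := (act v).

Lemma iter_actD n x y : iter n T (x + y) = iter n T x + iter n T y.
Proof.
elim: n => //= n ->; rewrite /act cmulDr; lmod R[i].
Qed.

Lemma iter_actZ n c x : iter n T (c *: x) = c *: iter n T x.
Proof. by elim: n => //= n ->; rewrite /act cmulZr scalerDr. Qed.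

Lemma iter_act0 n : iter n T 0 = 0.
Proof. by elim: n => //= n ->; rewrite /act cmul0r addr0. Qed.

Lemma iter_actB n x y : iter n T (x - y) = iter n T x - iter n T y.
Proof. by rewrite iter_actD -scaleN1r iter_actZ scaleN1r. Qed.

Lemma iter_act_sum n (I : Type) (r : seq I) (P : pred I) (F : I -> A) :
  iter n T (\sum_(i <- r | P i) F i) = \sum_(i <- r | P i) iter n T (F i).
Proof.
by elim/big_ind2 : _ => [|a b a' b' <- <-|//]; rewrite ?iter_act0 ?iter_actD.
Qed.

Lemma iter_actM n x y : iter n T x ** y = iter n T (x ** y).
Proof. by elim: n => //= n <-; rewrite /act cmulDl cmulA. Qed.

Lemma iter_act_mem n S : closed_subalgebra S -> S v ->
  exists2 p, S p & forall x, iter n T x = x + p ** x.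
Proof.
move=> [[S0 SD SZ] _ SM] Sv.
elim: n => [|n [p Sp ep]]; first by exists 0 => // x; rewrite cmul0l addr0.
exists (p + v + v ** p) => [|x]; first by apply: (SD); [exact: SD|exact: SM].
by rewrite /= ep /act !cmulDl cmulDr cmulA; lmod R[i].
Qed.

Hypothesis uv : unitary v.

Lemma nrm_act x : nrm (T x) = nrm x.
Proof.
apply/eqP; rewrite -(eqrXn2 (n := 2)) ?nrm_ge0//; apply/eqP.
rewrite -!nrm_sqr /act cstarD cstarM cmulDl !cmulDr.
have -> : cstar x ** cstar v ** (v ** x) =
    - (cstar x ** (v ** x)) - cstar x ** cstar v ** x.
  rewrite -!cmulA -cmulNr -cmulBr; congr (cmul (cstar x) _).
  rewrite !cmulA -cmulNl -cmulBl; congr (cmul _ x).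
  by have [_ /eqP] := uv; rewrite addrC addr_eq0 => /eqP ->; lmod R[i].
congr nrm; lmod R[i].
Qed.

Lemma nrm_iter_act n x : nrm (iter n T x) = nrm x.
Proof. by elim: n => //= n <-; rewrite nrm_act. Qed.

Lemma act_starK x : T (act (cstar v) x) = x.
Proof.
rewrite /act cmulDr cmulA.
have [/eqP + _] := uv; rewrite addrC addr_eq0 => /eqP ->.
by rewrite cmulNl cmulDl; lmod R[i].
Qed.

Definition mean n x := (n%:R : R[i])^-1 *: \sum_(j < n) iter j T x.

Lemma nrm_mean n x : nrm (mean n x) <= nrm x.
Proof.
case: n => [|n]; first by rewrite /mean big_ord0 scaler0 nrm0 nrm_ge0.
rewrite nrmZ cabsV -[_%:R]/(n.+1%:R) -(rmorph_nat (real_complex R)).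
rewrite cabs_real ger0_norm// mulrC ler_pdivrMr//.
rewrite (le_trans (nrm_sum _ _ _))//.
under eq_bigr do rewrite nrm_iter_act.
by rewrite sumr_const card_ord mulr_natr.
Qed.

Lemma mean_mul n x y : mean n x ** y = mean n (x ** y).
Proof.
by rewrite cmulZl cmul_suml; under eq_bigr do rewrite iter_actM.
Qed.

Lemma meanB n x y : mean n (x - y) = mean n x - mean n y.
Proof.
rewrite /mean -scalerBr -sumrB; congr (_ *: _).
by apply: eq_bigr => i _; rewrite iter_actB.
Qed.

Lemma meanZ n c x : mean n (c *: x) = c *: mean n x.
Proof.
rewrite /mean scalerA mulrC -scalerA; congr (_ *: _); rewrite scaler_sumr.
by apply: eq_bigr => i _; rewrite iter_actZ.
Qed.

(** [v ** x] is [act v x - x], so its mean telescopes to two terms of norm [nrm x], divided by [n].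
    For [n = 0] both sides vanish. *)
Lemma nrm_mean_coboundary n x : nrm (mean n (v ** x)) <= 2 * nrm x / n%:R.
Proof.
case: n => [|n].
  by rewrite /mean big_ord0 scaler0 nrm0 invr0 mulr0.
have -> : v ** x = T x - x by rewrite /act; lmod R[i].
have -> : mean n.+1 (T x - x) = (n.+1%:R : R[i])^-1 *: (iter n.+1 T x - x).
  congr (_ *: _); under eq_bigr do rewrite iter_actB -iterSr.
  by rewrite -(big_mkord xpredT (fun i => iter i.+1 T x - iter i T x)) telescope_sumr.
rewrite nrmZ cabsV -(rmorph_nat (real_complex R)) cabs_real ger0_norm//.
rewrite mulrC ler_wpM2r ?invr_ge0//.
by rewrite (le_trans (nrmB _ _))// nrm_iter_act; lra.
Qed.

(** By the C*-identity the left side is the norm of the mean of [x ** cstar (mean n x)]. Averaging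
    is a contraction, and an adjoint brings the mean back onto [x ** cstar x]. *)
Lemma nrm_mean_sqr n x : nrm (mean n x) ^+ 2 <= nrm (mean n (x ** cstar x)).
Proof.
rewrite -nrm_sqr' mean_mul (le_trans (nrm_mean _ _))//.
by rewrite -nrm_star cstarM cstarK mean_mul.
Qed.

(** [p] is [1] minus the mean of the powers of [1 + v]. When [v] is in an ideal, [x] is congruent to
    its mean; when the mean of [x] is small, [p] is an approximate unit for [x]. *)
Lemma mean_mem n S : (0 < n)%N -> closed_subalgebra S -> S v ->
  exists2 p, S p & forall x, x - mean n x = p ** x.
Proof.
move=> n0 SS Sv; have [[S0 SD SZ] cS SM] := SS.
have /choice[p Hp] : forall j, exists p, S p /\ forall x, iter j T x = x + p ** x.
  by move=> j; have [p Sp ep] := iter_act_mem j SS Sv; exists p.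
exists (- (n%:R : R[i])^-1 *: \sum_(j < n) p j).
  by apply: (SZ); apply: subspace_sum => // j _; have [] := Hp j.
move=> x; rewrite /mean.
under eq_bigr => j _ do rewrite (Hp j).2.
rewrite big_split/= sumr_const card_ord -(scaler_nat n x) scalerDr scalerA.
rewrite mulVf ?pnatr_eq0 ?lt0n_neq0// -cmul_suml cmulZl.
by set s := cmul _ x; lmod R[i].
Qed.

End Act.

Lemma scale_lt1 x : exists2 t : R, 0 < t & nrm (t%:C%C *: x) < 1.
Proof.
exists (1 + nrm x)^-1; first by rewrite invr_gt0 ltr_pwDl// nrm_ge0.
rewrite nrmZ cabs_real ger0_norm ?invr_ge0; last by have := nrm_ge0 x; lra.
by have x0 := nrm_ge0 x; rewrite mulrC ltr_pdivrMr ?mul1r; lra.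
Qed.

(* Cesaro means of the powers of the Cayley transform of [y] converge to the
   projection on the kernel of [y]; they replace an approximate unit. *)
Lemma mean_vanishing y : cstar y = y ->
  exists v, [/\ unitary v, forall S, closed_subalgebra S -> S y -> S v &
    forall e : R, 0 < e -> exists2 n, (0 < n)%N & nrm (mean v n y) < e].
Proof.
move=> ys.
have [t t0 k1] := scale_lt1 y.
pose k := t%:C%C *: y.
have ks : cstar k = k by rewrite cstarZ ys; congr (_ *: _); exact: conjc_real.
have [v [uv _ ev Sv]] := cayley ks k1.
exists v; split=> // [S SS Sy|e e0].
  by apply: Sv => //; have [[_ _ SZ] _ _] := SS; apply: SZ.
pose D := t^-1 * nrm (y - 'i%C *: (k ** y)).
(* The Cayley relation [v (1 - ik) = 2ik] makes [y ** y] a multiple of an element [v ** _], whose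
   mean decays like [1 / n]; [nrm_mean_sqr] transfers this to [y]. *)
have bound n : nrm (mean v n y) ^+ 2 <= D / n%:R.
  rewrite (le_trans (nrm_mean_sqr _ _ _))// ys.
  have -> : y ** y = ((2 * 'i%C)^-1 * t^-1%:C%C) *: (v ** (y - 'i%C *: (k ** y))).
    have -> : v ** (y - 'i%C *: (k ** y)) = (2 * 'i%C * t%:C%C) *: (y ** y).
      rewrite cmulBr {1}ev /k !(cmulDl, cmulZl, cmulZr) -cmulA.
      by lmod R[i].
    rewrite scalerA -[LHS]scale1r; congr (_ *: _).
    have i0 : 'i%C != 0 :> R[i] by rewrite eq_complex/= oner_eq0 andbF.
    have t0' : t%:C%C != 0 by rewrite eq_complex/= eqxx andbT gt_eqF.
    rewrite fmorphV; by field; rewrite i0 t0'.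
  rewrite meanZ nrmZ cabsM cabsV cabsM cabs_i mulr1.
  rewrite -[2]/(2%:R) -(rmorph_nat (real_complex R)) !cabs_real.
  have ti0 : 0 < t^-1 by rewrite invr_gt0.
  rewrite gtr0_norm// (gtr0_norm ti0) -mulrA.
  have := nrm_mean_coboundary uv n (y - 'i%C *: (k ** y)).
  rewrite -(ler_pM2l ti0) => H.
  rewrite (le_trans (ler_wpM2l _ H)) ?invr_ge0// /D.
  have -> : forall a b c : R, 2^-1 * (a * (2 * b / c)) = a * b / c.
    by move=> a b c; rewrite -(mulrA 2) (mulrCA a) mulKf ?mulrA.
  exact: lexx.
have D0 : 0 <= D by rewrite mulr_ge0 ?nrm_ge0// ltW// invr_gt0.
have [N HN] : exists N : nat, D / e ^+ 2 < N%:R.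
  by exists (Num.bound (D / e ^+ 2)); rewrite archi_boundP// divr_ge0// exprn_ge0// ltW.
have N0 : (0 < N)%N.
  rewrite -(ltr_nat R); apply: le_lt_trans HN.
  by rewrite divr_ge0// exprn_ge0// ltW.
exists N => //.
rewrite -(@ltr_pXn2r _ 2) ?nnegrE ?nrm_ge0 ?(ltW e0)//.
rewrite (le_lt_trans (bound _))// ltr_pdivrMr ?ltr0n//.
by rewrite mulrC -ltr_pdivrMr ?exprn_gt0.
Qed.

End Unitaries.

(** * Ideals and quotient norms *)

Section Ideals.
Context {R : realType} {A : cstarAlgType R}.
Implicit Types (x y z a b : A) (c : R[i]) (S I B : set A).

Lemma ideal_subspace B I : is_ideal B I -> subspace I.
Proof. by case=> _ /submod_closedP. Qed.

Lemma ideal_adherent B I x : is_ideal B I -> adherent I x -> I x.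
Proof. by case=> _ _ /closed_adherent cI _; apply: cI. Qed.

Lemma ideal_subalgebra B I : is_ideal B I -> closed_subalgebra I.
Proof.
move=> hI; split; first exact: ideal_subspace hI; case: hI => //.
by move=> IB _ _ IM x y /IB Bx Iy; have [] := IM x y Bx Iy.
Qed.

Lemma idealMl I a x : is_ideal [set: A] I -> I x -> I (a ** x).
Proof. by case=> _ _ _ IM Ix; have [] := IM a x Logic.I Ix. Qed.

Lemma idealMr I a x : is_ideal [set: A] I -> I x -> I (x ** a).
Proof. by case=> _ _ _ IM Ix; have [] := IM a x Logic.I Ix. Qed.

(** The means built from [cstar x ** x] give [p] in [I] with [p ** cstar x] close to [cstar x]; this
    product is in [I] because [cstar x] is in [B]. *)
Lemma ideal_star B I x : (forall y, B y -> B (cstar y)) -> is_ideal B I ->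
  I x -> I (cstar x).
Proof.
move=> sB hI Ix; have [IB _ _ IM] := hI.
have [|v [uv Sv small]] := @mean_vanishing _ _ (cstar x ** x).
  by rewrite cstarM cstarK.
have Iv : I v.
  apply: Sv; first exact: ideal_subalgebra hI.
  by have [] := IM (cstar x) x (sB _ (IB _ Ix)) Ix.
apply: (ideal_adherent hI) => e e0; have [n n0 ne] := small _ (exprn_gt0 2 e0).
have [p Ip ep] := mean_mem n0 (ideal_subalgebra hI) Iv.
exists (p ** cstar x).
  by have [] := IM (cstar x) p (sB _ (IB _ Ix)) Ip.
rewrite -ep opprB addrC subrK -(@ltr_pXn2r _ 2) ?nnegrE ?nrm_ge0 ?(ltW e0)//.
by rewrite (le_lt_trans (nrm_mean_sqr uv _ _))// cstarK.
Qed.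

Lemma ideal_starT I x : is_ideal [set: A] I -> I x -> I (cstar x).
Proof. exact: ideal_star. Qed.

(** With an approximate unit [p] of [x] taken in [I], [a ** x] is a limit of elements
    [(a ** p) ** x], where [a ** p] is in [B]; adjoints give the other side. The maximal ideals of
    [B] can then be treated as ideals of [A]. *)
Lemma ideal_trans B I : is_ideal [set: A] B -> is_ideal B I ->
  is_ideal [set: A] I.
Proof.
move=> hB hI; have [IB sI cI IM] := hI.
have sI' x : I x -> I (cstar x).
  by apply: ideal_star hI => y; apply: ideal_starT.
have left a x : I x -> I (a ** x).
  move=> Ix; have [|v [uv Sv small]] := @mean_vanishing _ _ (x ** cstar x).
    by rewrite cstarM cstarK.
  have Iv : I v.
    apply: Sv; first exact: ideal_subalgebra hI.
    by have [_] := IM (cstar x) x (IB _ (sI' _ Ix)) Ix.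
  have a0 : 0 < nrm a + 1 by rewrite ltr_wpDl// nrm_ge0.
  apply: (ideal_adherent hI) => e e0.
  have [n n0 ne] := small _ (exprn_gt0 2 (divr_gt0 e0 a0)).
  have [p Ip ep] := mean_mem n0 (ideal_subalgebra hI) Iv.
  exists (a ** p ** x).
    have [] // := IM (a ** p) x _ Ix; apply: idealMl hB _.
    exact: IB.
  rewrite -cmulA -ep -cmulBr opprB addrC subrK.
  have : nrm (mean v n x) < e / (nrm a + 1).
    rewrite -(@ltr_pXn2r _ 2) ?nnegrE ?nrm_ge0 ?(ltW (divr_gt0 e0 a0))//.
    by rewrite (le_lt_trans (nrm_mean_sqr uv _ _)).
  rewrite ltr_pdivlMr// => H; rewrite (le_lt_trans (nrmM _ _))//.
  by apply: le_lt_trans H; rewrite mulrC ler_wpM2l ?nrm_ge0// lerDl.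
split=> // a x _ Ix; split; first exact: left.
by rewrite -(cstarK (x ** a)) cstarM; apply/sI'/left/sI'.
Qed.

(** The commutator [w] of [z] and [a] lies in [B] and satisfies [w ** y = 0] for [y] in [B]; for
    [y = cstar w] the C*-identity gives [w = 0]. *)
Lemma centre_ideal B z a : is_ideal [set: A] B -> centre B z -> z ** a = a ** z.
Proof.
move=> hB [Bz zB]; apply/eqP; rewrite -subr_eq0; apply/eqP.
set w := _ - _; have Bw : B w.
  by apply: subspaceB; [exact: ideal_subspace hB|exact: idealMr|exact: idealMl].
have wy y : B y -> w ** y = 0.
  move=> By; rewrite /w cmulBl -!cmulA (zB y)// (zB (a ** y)); last exact: idealMl.
  by rewrite cmulA subrr.
apply: nrm0_eq0; apply/eqP; rewrite -sqrf_eq0 -nrm_sqr' wy ?nrm0//.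
exact: ideal_starT.
Qed.

Lemma centre_subalgebra B : is_ideal [set: A] B -> closed_subalgebra (centre B).
Proof.
move=> hB; have [[B0 BD BZ] cB BM] := ideal_subalgebra hB.
split.
- split=> [|x y [Bx xB] [By yB]|c x [Bx xB]].
  + by split=> // b _; rewrite cmul0l cmul0r.
  + by split=> [|b Bb]; [exact: BD|rewrite cmulDl cmulDr xB// yB].
  + by split=> [|b Bb]; [exact: BZ|rewrite cmulZl cmulZr xB].
- apply/closed_adherent => x Zx; split.
    by apply: (ideal_adherent hB) => e /Zx[y [By _] xy]; exists y.
  move=> b Bb; apply/eqP; rewrite -subr_eq0; apply/eqP/nrm0_eq0/eqP.
  rewrite eq_le nrm_ge0 andbT; apply/ler_addgt0Pl => e e0; rewrite addr0.
  have d0 : 0 < 2 * (nrm b + 1) by have := nrm_ge0 b; lra.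
  have [y [By yB]] := Zx _ (divr_gt0 e0 d0); rewrite ltr_pdivlMr// => xy.
  have -> : x ** b - b ** x = (x - y) ** b - b ** (x - y).
    by rewrite cmulBl cmulBr yB//; lmod R[i].
  rewrite (le_trans (nrmB _ _))//.
  have := nrmM (x - y) b; have := nrmM b (x - y).
  have := nrm_ge0 b; have := nrm_ge0 (x - y); nra.
- move=> x y [Bx xB] [By yB]; split=> [|b Bb]; first exact: BM.
  by rewrite -cmulA yB// cmulA xB// -cmulA.
Qed.

Lemma centre_star B z : is_ideal [set: A] B -> centre B z -> centre B (cstar z).
Proof.
move=> hB [Bz zB]; split=> [|b Bb]; first exact: ideal_starT.
by rewrite -[LHS]cstarK cstarM cstarK -zB ?cstarM ?cstarK//; exact: ideal_starT.
Qed.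

Lemma unitary_star (v : A) : unitary v -> unitary (cstar v).
Proof. by case=> e1 e2; split; rewrite cstarK (addrC (cstar v)). Qed.

Lemma star_actK (v : A) x : unitary v -> act (cstar v) (act v x) = x.
Proof. by move=> /unitary_star/act_starK => /(_ x); rewrite cstarK. Qed.

Definition qnorm I x : R := inf [set nrm (x - y) | y in I].

Lemma zero_ideal : is_ideal [set: A] [set 0].
Proof.
split=> //.
- apply/submod_closedP; split=> //= [x y -> ->|c x ->]; first by rewrite addr0.
  by rewrite scaler0.
- apply/closed_adherent => x x0; apply: nrm0_eq0; apply/eqP.
  rewrite eq_le nrm_ge0 andbT; apply/ler_addgt0Pl => e /x0[_ ->].
  by rewrite subr0 addr0 => /ltW.
- by move=> b x _ ->; rewrite cmul0l cmul0r.
Qed.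

Section QuotientNorm.
Variable I : set A.
Hypothesis hI : is_ideal [set: A] I.
Local Notation q := (qnorm I).

Let I0 : I 0. Proof. by have [] := ideal_subspace hI. Qed.

Lemma qnorm_lb y : I y -> forall x, q x <= nrm (x - y).
Proof.
move=> Iy x; apply: ge_inf; last by exists y.
by exists 0 => _ [z _ <-]; exact: nrm_ge0.
Qed.

Lemma qnorm_lt x r : q x < r -> exists2 y, I y & nrm (x - y) < r.
Proof.
move=> /inf_lt[]; first by exists (nrm (x - 0)), 0.
by move=> _ [y Iy <-]; exists y.
Qed.

Lemma qnorm_ge0 x : 0 <= q x.
Proof.
apply: lb_le_inf; first by exists (nrm (x - 0)), 0.
by move=> _ [y _ <-]; exact: nrm_ge0.
Qed.

Lemma qnorm_le_nrm x : q x <= nrm x.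
Proof. by rewrite -{2}(subr0 x) qnorm_lb. Qed.

Lemma qnorm_mem x : I x -> q x = 0.
Proof.
move=> Ix; apply/eqP; rewrite eq_le qnorm_ge0 andbT.
by rewrite -(@nrm0 R A) -(subrr x) qnorm_lb.
Qed.

Lemma qnorm_eq0 x : q x = 0 -> I x.
Proof.
move=> qx; apply: (ideal_adherent hI) => e e0.
by have [|y Iy xy] := @qnorm_lt x e; [rewrite qx|exists y].
Qed.

Lemma qnorm_gt0 x : ~ I x -> 0 < q x.
Proof.
by move=> nIx; rewrite lt_neqAle qnorm_ge0 andbT eq_sym; apply/eqP => /qnorm_eq0.
Qed.

Lemma qnormD x y : q (x + y) <= q x + q y.
Proof.
apply/ler_addgt0Pl => e e0; have e2 : 0 < e / 2 by lra.
have [|a Ia xa] := @qnorm_lt x (q x + e / 2); first lra.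
have [|b Ib yb] := @qnorm_lt y (q y + e / 2); first lra.
have Iab : I (a + b) by have [_ ID _] := ideal_subspace hI; apply: ID.
rewrite (le_trans (qnorm_lb Iab _))//.
by have := nrmD (x - a) (y - b); rewrite addrACA -opprD; lra.
Qed.

Lemma qnormZ c x : q (c *: x) = nrm c * q x.
Proof.
have le c' x' : q (c' *: x') <= nrm c' * q x'.
  apply/ler_addgt0Pl => e e0.
  have c0 : 0 < nrm c' + 1 by rewrite ltr_wpDl// nrm_ge0.
  have [|y Iy xy] := @qnorm_lt x' (q x' + e / (nrm c' + 1)).
    by rewrite ltrDl divr_gt0.
  have Icy : I (c' *: y) by have [_ _ IZ] := ideal_subspace hI; apply: IZ.
  rewrite (le_trans (qnorm_lb Icy _))// -scalerBr nrmZ.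
  rewrite (le_trans (ler_wpM2l (nrm_ge0 _) (ltW xy)))//.
  rewrite mulrDr addrC lerD2r mulrCA ger_pMr// ler_pdivrMr ?mul1r ?lerDl//.
have [->|c0] := eqVneq c 0; first by rewrite scale0r nrm0 mul0r qnorm_mem.
apply/eqP; rewrite eq_le le/=.
rewrite -{1}(scale1r x) -(mulVf c0) -scalerA.
have n0 : 0 < nrm c.
  by rewrite lt_neqAle nrm_ge0 andbT eq_sym; apply: contra_neq c0 => /nrm0_eq0.
rewrite (le_trans (ler_wpM2l (nrm_ge0 _) (le _ _)))//.
by rewrite cabsV mulrA mulfV ?mul1r// gt_eqF.
Qed.

Lemma qnormN x : q (- x) = q x.
Proof. by rewrite -scaleN1r qnormZ nrmN cabs1 mul1r. Qed.

Lemma qnormB x y : q (x - y) <= q x + q y.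
Proof. by rewrite -(qnormN y) qnormD. Qed.

Lemma qnorm_sum (J : Type) (r : seq J) (P : pred J) (F : J -> A) :
  q (\sum_(i <- r | P i) F i) <= \sum_(i <- r | P i) q (F i).
Proof.
elim/big_ind2 : _ => [|x a y b xa yb|//]; first by rewrite qnorm_mem.
by rewrite (le_trans (qnormD _ _))// lerD.
Qed.

Lemma qnorm_congr x y : I (x - y) -> q x = q y.
Proof.
move=> Ixy; apply/eqP; rewrite eq_le; apply/andP; split.
  by have := qnormD (x - y) y; rewrite subrK (qnorm_mem Ixy) add0r.
by have := qnormB x (x - y); rewrite opprB addrC subrK (qnorm_mem Ixy) addr0.
Qed.

Lemma qnormM x y : q (x ** y) <= q x * q y.
Proof.
apply/ler_addgt0Pl => e e0.
pose D := q x + q y + 1; have qx := qnorm_ge0 x; have qy := qnorm_ge0 y.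
have D0 : 0 < D by rewrite /D; lra.
(* With this [d], [(q x + d) * (q y + d)] exceeds [q x * q y] by at most [d * D], hence by at most
   [e]. *)
pose d := Num.min 1 (e / D).
have d0 : 0 < d by rewrite /d lt_min ltr01 divr_gt0.
have [|a Ia xa] := @qnorm_lt x (q x + d); first lra.
have [|b Ib yb] := @qnorm_lt y (q y + d); first lra.
have Iab : I (x ** y - (x - a) ** (y - b)).
  have -> : x ** y - (x - a) ** (y - b) = x ** b + a ** (y - b).
    by rewrite cmulBl !cmulBr; lmod R[i].
  by have [_ ID _] := ideal_subspace hI; apply: ID; [exact: idealMl|exact: idealMr].
rewrite (qnorm_congr Iab) (le_trans (qnorm_le_nrm _))// (le_trans (nrmM _ _))//.
have d1 : d <= 1 by rewrite /d ge_min lexx.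
have dD : d * D <= e by rewrite -ler_pdivlMr// /d ge_min lexx orbT.
have := nrm_ge0 (x - a); have := nrm_ge0 (y - b).
rewrite /D in dD; nra.
Qed.

Lemma qnorm_star x : q (cstar x) = q x.
Proof.
have le y : q (cstar y) <= q y.
  apply/ler_addgt0Pl => e e0; have [|a Ia ya] := @qnorm_lt y (e + q y); first lra.
  rewrite (le_trans (qnorm_lb (ideal_starT hI Ia) _))//.
  by rewrite -cstarB nrm_star ltW.
by apply/eqP; rewrite eq_le le -{1}(cstarK x) le.
Qed.

(** For the hard inequality, take [y] in [I] self-adjoint and nearly closest to [x ** cstar x], and
    let [v] come from [y]. Modulo [I], [x] is its own mean, whose squared norm is at most that of
    the mean of [x ** cstar x], hence at most the norm of [x ** cstar x - y] plus that of the mean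
    of [y]. *)
Lemma qnorm_sqr x : q (x ** cstar x) = q x ^+ 2.
Proof.
apply/eqP; rewrite eq_le; apply/andP; split.
  by rewrite (le_trans (qnormM _ _))// qnorm_star expr2.
apply/ler_addgt0Pl => e e0; have e2 : 0 < e / 2 by lra.
have [|y' Iy' xy'] := @qnorm_lt (x ** cstar x) (q (x ** cstar x) + e / 2); first lra.
(* Averaging with the adjoint makes [y] self-adjoint and preserves the bound on the distance, as
   [x ** cstar x] is self-adjoint. *)
pose y := (2 : R[i])^-1 *: (y' + cstar y').
have two : Num.conj (2^-1 : R[i]) = 2^-1 by rewrite fmorphV/= conjC_nat.
have ys : cstar y = y by rewrite cstarZ cstarD cstarK addrC two.
have [_ ID IZ] := ideal_subspace hI.
have Iy : I y by apply/IZ/ID => //; exact: ideal_starT.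
have xy : nrm (x ** cstar x - y) < q (x ** cstar x) + e / 2.
  have -> : x ** cstar x - y =
      (2 : R[i])^-1 *: ((x ** cstar x - y') + cstar (x ** cstar x - y')).
    rewrite cstarB cstarM cstarK.
    have -> : x ** cstar x - y = (2^-1 * 2 : R[i]) *: (x ** cstar x) - y.
      by rewrite mulVf ?scale1r// pnatr_eq0.
    by rewrite /y; lmod R[i].
  rewrite nrmZ cabsV -[2]/(2%:R) -(rmorph_nat (real_complex R)) cabs_real.
  rewrite ger0_norm// mulrC ltr_pdivrMr//.
  by have := nrmD (x ** cstar x - y') (cstar (x ** cstar x - y')); rewrite nrm_star; lra.
have [v [uv Sv small]] := mean_vanishing ys.
have SI := ideal_subalgebra hI; have Iv : I v by apply: Sv.
have [n n0 ne] := small _ e2; have [p Ip ep] := mean_mem n0 SI Iv.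
have Ix : I (x - mean v n x) by rewrite ep; apply: idealMr.
rewrite (qnorm_congr Ix).
have := qnorm_le_nrm (mean v n x); have := qnorm_ge0 (mean v n x).
have := nrm_mean_sqr uv n x.
have := nrmD (mean v n (x ** cstar x - y)) (mean v n y).
rewrite {1}meanB subrK; have := nrm_mean uv n (x ** cstar x - y).
nra.
Qed.

Lemma qnorm_act v x : unitary v -> q (act v x) = q x.
Proof.
have le w y : unitary w -> q (act w y) <= q y.
  move=> uw; apply/ler_addgt0Pl => e e0.
  have [|a Ia ya] := @qnorm_lt y (e + q y); first lra.
  have Iwa : I (act w a).
    by have [_ ID _] := ideal_subspace hI; apply: ID => //; apply: idealMl.
  rewrite (le_trans (qnorm_lb Iwa _))//.
  by rewrite -(iter_actB w 1) nrm_act// ltW.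
move=> uv; apply/eqP; rewrite eq_le le//= -{1}(star_actK x uv) le//.
exact: unitary_star.
Qed.

Lemma qnorm_iter_act v n x : unitary v -> q (iter n (act v) x) = q x.
Proof. by move=> uv; elim: n => //= n <-; rewrite qnorm_act. Qed.

End QuotientNorm.

Lemma qnorm_zero x : qnorm [set 0] x = nrm x.
Proof.
apply/eqP; rewrite eq_le qnorm_le_nrm ?andTb; last exact: zero_ideal.
apply: lb_le_inf; first by exists (nrm (x - 0)), 0.
by move=> _ [_ -> <-]; rewrite subr0.
Qed.

End Ideals.

(** * A von Neumann inequality for central unitaries *)

Section Circle.
Context {R : realType}.
Implicit Types (t s : R) (n : nat).

Definition expi t : R[i] := (cos t +i* sin t)%C.

Lemma expi0 : expi 0 = 1.
Proof. by rewrite /expi cos0 sin0. Qed.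

Lemma expiD t s : expi (t + s) = expi t * expi s.
Proof. by rewrite /expi cosD sinD; simpc; rewrite (addrC (sin t * _)). Qed.

Lemma expiMn n t : expi (n%:R * t) = expi t ^+ n.
Proof.
elim: n => [|n IH]; first by rewrite mul0r expi0 expr0.
by rewrite -natr1 mulrDl mul1r expiD IH exprSr.
Qed.

Lemma nrm_expi t : nrm (expi t) = 1.
Proof. by rewrite /nrm normc_def/= cos2Dsin2 sqrtr1. Qed.

Lemma expi_neq0 t : expi t != 0.
Proof.
by apply/eqP => e0; have := nrm_expi t; rewrite e0 nrm0 => /eqP; rewrite eq_sym oner_eq0.
Qed.

Lemma expi_conj t : Num.conj (expi t) = (expi t)^-1.
Proof.
apply: (mulfI (expi_neq0 t)); rewrite cabs_sqr nrm_expi expr1n mulfV//.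
exact: expi_neq0.
Qed.

Lemma expi_neq1 t : 0 < t < pi *+ 2 -> expi t != 1.
Proof.
move=> /andP[t0 t1]; have s0 : 0 < sin (t / 2).
  by apply: sin_gt0_pi; rewrite divr_gt0//= ltr_pdivrMr// mulr_natr.
apply/eqP => /(congr1 (@complex.Re R))/=.
have -> : t = t / 2 + t / 2 by lra.
rewrite cosD -!expr2 cos2sin2 => e.
by have := exprn_gt0 2 s0; lra.
Qed.

Definition root1 n := expi (pi *+ 2 / n%:R).

Lemma root1_prim n : (0 < n)%N -> n.-primitive_root (root1 n).
Proof.
move=> n0; rewrite /primitive_root_of_unity n0 /=; apply/forallP => i.
rewrite unity_rootE /root1 -expiMn eq_sym; apply/eqP.
have n0' : n%:R != 0 :> R by rewrite pnatr_eq0 -lt0n.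
have p0 : 0 < pi *+ 2 :> R by rewrite pmulrn_lgt0//; exact: pi_gt0.
have [->|ni] := eqVneq i.+1 n.
  rewrite mulrCA mulfV// mulr1 mulr2n expiD.
  by rewrite /expi cospi sinpi; simpc; apply/esym/eqP.
apply/esym/negbTE; apply: expi_neq1; apply/andP; split.
  by rewrite mulr_gt0 ?ltr0n// divr_gt0 ?ltr0n.
rewrite mulrCA gtr_pMr// ltr_pdivrMr ?ltr0n// mul1r ltr_nat.
by rewrite ltn_neqAle ni ltn_ord.
Qed.

Lemma root1_exp n j : root1 n ^+ j = expi (j%:R * (pi *+ 2 / n%:R)).
Proof. by rewrite expiMn. Qed.

(** Orthogonality of the characters of the cyclic group of order [n]: a geometric sum whose ratio is
    an [n]-th root of unity, different from one when [k != l]. *)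
Lemma root1_sum n (k l : nat) : (k < n)%N -> (l < n)%N ->
  \sum_(j < n) (root1 n ^+ j) ^+ l / (root1 n ^+ j) ^+ k = if k == l then n%:R else 0.
Proof.
move=> kn ln; have n0 : (0 < n)%N by apply: leq_ltn_trans kn.
have w0 : root1 n != 0 by exact: expi_neq0.
pose x := root1 n ^+ l / root1 n ^+ k.
rewrite (eq_bigr (fun j : 'I_n => x ^+ j)); last first.
  by move=> j _; rewrite /x expr_div_n -!exprM mulnC (mulnC k).
have [kl|kl] := eqVneq k l.
  rewrite /x kl mulfV ?expf_neq0//.
  by under eq_bigr do rewrite expr1n; rewrite sumr_const card_ord.
have x1 : x - 1 != 0.
  rewrite subr_eq0; apply: contra kl => /eqP xe.
  have : root1 n ^+ l == root1 n ^+ k.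
    by rewrite -[X in _ == X]mul1r -xe divfK ?expf_neq0.
  by rewrite (eq_prim_root_expr (root1_prim n0)) !modn_small// eq_sym.
apply: (mulfI x1); rewrite -subrX1 mulr0 /x expr_div_n -!exprM !(mulnC _ n) !exprM.
by rewrite (prim_expr_order (root1_prim n0)) !expr1n divr1 subrr.
Qed.

End Circle.

Section PowerTrick.
Context {R : realType}.
Implicit Types (r C d : R).

Lemma bernoulli d n : 0 <= d -> 1 + n%:R * d <= (1 + d) ^+ n.
Proof.
move=> d0; elim: n => [|n IH]; first by rewrite mul0r addr0 expr0.
rewrite exprS -natr1; have : 0 <= n%:R :> R by []. nra.
Qed.

(** If [r = (1 + s) C] with [s > 0], the hypothesis bounds [(1 + s) ^ (2N)] by [2 N d] for [N] a
    power of two, whereas the square of Bernoulli's inequality bounds it below by [N ^ 2 s ^ 2].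
    Without squaring, both bounds would be linear in [N]. *)
Lemma power_trick r C d : 0 <= r -> 0 <= C -> 0 <= d ->
  (forall m, r ^+ (2 ^ m) <= (2 ^ m)%:R * d * C ^+ (2 ^ m)) -> r <= C.
Proof.
move=> r0 C0 d0 H; rewrite leNgt; apply/negP => Cr.
move: C0; rewrite le0r => /predU1P[C0|C0].
  by have := H 0%N; rewrite C0 !expr1 mulr0; lra.
pose s := r / C - 1; have s0 : 0 < s by rewrite subr_gt0 ltr_pdivlMr ?mul1r.
have Hs m : (1 + s) ^+ (2 ^ m) <= (2 ^ m)%:R * d.
  rewrite /s addrC subrK expr_div_n ler_pdivrMr ?exprn_gt0//.
have key m : (2 ^ m)%:R * s ^+ 2 <= 2 * d.
  have := Hs m.+1; rewrite expnS mulnC exprM natrM.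
  have := bernoulli (2 ^ m) (ltW s0).
  have : 0 < (2 ^ m)%:R :> R by rewrite ltr0n expn_gt0.
  set N : R := (2 ^ m)%:R; set X := _ ^+ _ => N0 hX.
  rewrite expr2 => hX2.
  have : (N * s) ^+ 2 <= N * 2 * d.
    apply: le_trans hX2; rewrite -expr2 ler_pXn2r ?nnegrE//; first by nra.
      by rewrite mulr_ge0// ltW.
    by apply: le_trans hX; nra.
  by rewrite exprMn expr2 -!mulrA ler_pM2l// mulrA.
pose m := Num.bound (2 * d / s ^+ 2).
have := key m; rewrite leNgt => /negP; apply.
rewrite -ltr_pdivrMr ?exprn_gt0//.
apply: lt_le_trans (_ : m%:R <= _); last by rewrite ler_nat ltnW// ltn_expl.
by apply: archi_boundP; apply: divr_ge0; [exact: mulr_ge0|exact: sqr_ge0].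
Qed.

End PowerTrick.

Section SymbolBound.
Context {R : realType} {A : cstarAlgType R}.
Variables (I : set A) (v : A).
Hypotheses (hI : is_ideal [set: A] I) (uv : unitary v).
Hypothesis cv : forall x, I (v ** x - x ** v).
Implicit Types (x y : A) (w : nat -> A) (z : R[i]) (d n : nat) (C : R).
Local Notation q := (qnorm I).
Local Notation T := (act v).

(** The polynomial with coefficients [w] at a scalar [z]; [laurent] is its value at the unitary
    [1 + v]. Negative powers are avoided by multiplying with a power of the unitary, which changes
    no norm. *)
Definition symbol z w d := \sum_(k < d) z ^+ k *: w k.
Definition laurent w d := \sum_(k < d) iter k T (w k).

(** Inversion of the discrete Fourier transform on the [d]-th roots of unity. *)
Lemma coef_symbol w d k : (k < d)%N ->
  w k = (d%:R : R[i])^-1 *: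
    \sum_(j < d) ((root1 d ^+ j) ^+ k)^-1 *: symbol (root1 d ^+ j) w d.
Proof.
move=> kd; rewrite /symbol;
under eq_bigr => j _ do rewrite scaler_sumr.
rewrite exchange_big /= (bigD1 (Ordinal kd))//= [X in _ + X]big1 ?addr0; last first.
  move=> l lk; under eq_bigr do rewrite scalerA mulrC.
  rewrite -scaler_suml root1_sum// ifF ?scale0r//.
  by apply: negbTE; rewrite eq_sym.
under eq_bigr do rewrite scalerA mulrC.
rewrite -scaler_suml root1_sum// eqxx scalerA mulVf ?scale1r//.
by rewrite pnatr_eq0 -lt0n (leq_ltn_trans _ kd).
Qed.

Lemma coef_bound w d C k : (forall t, q (symbol (expi t) w d) <= C) -> (k < d)%N ->
  q (w k) <= C.
Proof.
move=> H kd; rewrite (coef_symbol w kd) qnormZ// cabsV -(rmorph_nat (real_complex R)).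
have d0 : (0 < d)%N by apply: leq_ltn_trans kd.
rewrite cabs_real ger0_norm// mulrC ler_pdivrMr ?ltr0n//.
rewrite (le_trans (qnorm_sum hI _ _ _))//.
have -> : C * d%:R = \sum_(j < d) C by rewrite sumr_const card_ord mulr_natr.
apply: ler_sum => j _; rewrite qnormZ// cabsV !cabsX nrm_expi !expr1n invr1 mul1r.
by rewrite root1_exp.
Qed.

Lemma laurent_bound_linear w d C : (forall t, q (symbol (expi t) w d) <= C) ->
  q (laurent w d) <= d%:R * C.
Proof.
move=> H; rewrite (le_trans (qnorm_sum hI _ _ _))//.
have -> : d%:R * C = \sum_(j < d) C by rewrite sumr_const card_ord mulr_natl.
by apply: ler_sum => j _; rewrite qnorm_iter_act// (coef_bound H).
Qed.

Lemma ideal_iter_act n x : I x -> I (iter n T x).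
Proof.
move=> Ix; elim: n => //= n IH.
have [_ ID _] := ideal_subspace hI; apply: ID => //; exact: idealMl.
Qed.

(** Modulo [I] the unitary [1 + v] commutes with everything, so its powers cancel against their
    adjoints. *)
Lemma iter_act_star n x y : I (iter n T (x ** cstar (iter n T y)) - x ** cstar y).
Proof.
have [I0 ID IZ] := ideal_subspace hI.
have one (z : A) : I (T (x ** cstar (T z)) - x ** cstar z).
  rewrite /act cstarD cstarM !cmulDr.
  have [/eqP + _] := uv; rewrite addrC addr_eq0 => /eqP e.
  set u := x ** cstar z.
  have -> : x ** (cstar z ** cstar v) = u ** cstar v by rewrite /u cmulA.
  have -> : u + u ** cstar v + (v ** u + v ** (u ** cstar v)) - u =
     (v ** u - u ** v) + (v ** u - u ** v) ** cstar v.
    rewrite cmulBl -(cmulA u) e cmulNr cmulDr (cmulA v); lmod R[i].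
  by apply: ID => //; apply: idealMr.
elim: n => [|n IH]; first by rewrite subrr.
rewrite iterSr/=.
have := ID _ _ (ideal_iter_act n (one (iter n T y))) IH.
by rewrite iter_actB addrA subrK.
Qed.

(** Coefficients of the polynomial times its adjoint. The adjoint of a unitary is its inverse, so
    the exponents are [k - l]; the shift by [d] makes them nonnegative. *)
Definition square_coefs w d j :=
  \sum_(k < d) \sum_(l < d | (k + (d - l))%N == j) w k ** cstar (w l).

Lemma square_coefs_sum (F : nat -> A -> A) w d :
  (forall j, F j 0 = 0) -> (forall j x y, F j (x + y) = F j x + F j y) ->
  \sum_(j < d.*2) F j (square_coefs w d j) =
  \sum_(k < d) \sum_(l < d) F (k + (d - l))%N (w k ** cstar (w l)).
Proof.
move=> F0 FD.
have Fsum j (J : finType) (P : pred J) (G : J -> A) :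
    F j (\sum_(i | P i) G i) = \sum_(i | P i) F j (G i).
  by elim/big_ind2 : _ => // a b a' b' <- <-.
under eq_bigr do rewrite Fsum.
rewrite exchange_big; apply: eq_bigr => k _ /=.
under eq_bigr do rewrite Fsum big_mkcond.
rewrite exchange_big; apply: eq_bigr => l _ /=.
have kl : (k + (d - l) < d.*2)%N.
  by rewrite -addnn -addSn leq_add// leq_subr.
rewrite (bigD1 (Ordinal kl))//= eqxx big1 ?addr0// => j jk.
by rewrite ifF//; apply: contra_neqF jk => /eqP e; apply: val_inj.
Qed.

Lemma symbol_square z w d : z * Num.conj z = 1 ->
  symbol z (square_coefs w d) d.*2 = z ^+ d *: (symbol z w d ** cstar (symbol z w d)).
Proof.
move=> z1; rewrite /symbol (@square_coefs_sum (fun j x => z ^+ j *: x)); last 2 first.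
- by move=> j; rewrite scaler0.
- by move=> j x y; rewrite scalerDr.
rewrite cmul_suml scaler_sumr; apply: eq_bigr => k _.
rewrite cstar_sum cmul_sumr scaler_sumr; apply: eq_bigr => l _.
rewrite cstarZ cmulZl cmulZr !scalerA; congr (_ *: _).
have ld : (l <= d)%N by rewrite ltnW.
have -> : z ^+ d = z ^+ (d - l) * z ^+ l by rewrite -exprD subnK.
rewrite rmorphXn/= exprD.
transitivity (z ^+ k * z ^+ (d - l) * (z * Num.conj z) ^+ l).
  by rewrite z1 expr1n mulr1.
rewrite exprMn; ring.
Qed.

Lemma laurent_square w d :
  q (laurent (square_coefs w d) d.*2) = q (laurent w d) ^+ 2.
Proof.
rewrite -qnorm_sqr// -(qnorm_iter_act hI d (laurent w d ** _) uv).
apply: qnorm_congr => //.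
rewrite /laurent (@square_coefs_sum (fun j x => iter j T x)); last 2 first.
- by move=> j; rewrite iter_act0.
- by move=> j x y; rewrite iter_actD.
rewrite cmul_suml iter_act_sum -sumrB; apply: subspace_sum => [|k _].
  exact: ideal_subspace hI.
rewrite cstar_sum cmul_sumr iter_act_sum -sumrB.
apply: subspace_sum => [|l _]; first exact: ideal_subspace hI.
have ld : (l <= d)%N by rewrite ltnW.
have dkl : (d + k = k + (d - l) + l)%N by rewrite -addnA subnK// addnC.
rewrite iter_actM -iterD dkl (iterD (k + (d - l)) l) -opprB.
rewrite -iter_actB; apply: subspaceN; first exact: ideal_subspace hI.
by apply: ideal_iter_act; apply: iter_act_star.
Qed.

(* A von Neumann inequality: squaring [m] times multiplies the degree by [2 ^ m]
   only, so the factor [d] of [laurent_bound_linear] is washed out. *)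
Lemma laurent_bound w d C : (forall t, q (symbol (expi t) w d) <= C) ->
  q (laurent w d) <= C.
Proof.
move=> H; have C0 : 0 <= C := le_trans (qnorm_ge0 hI _) (H 0).
apply: (@power_trick _ _ _ d%:R) => //; first exact: qnorm_ge0.
move=> m; elim: m w d C C0 H => [|m IH] w d C C0 H.
  by rewrite !expr1 mul1r laurent_bound_linear.
rewrite expnS !exprM -laurent_square.
have {}IH := IH _ d.*2 (C ^+ 2) (exprn_ge0 2 C0).
apply: le_trans (IH (square_coefs w d) _) _.
  move=> t; rewrite symbol_square; last by rewrite cabs_sqr nrm_expi expr1n.
  rewrite qnormZ// cabsX nrm_expi expr1n mul1r qnorm_sqr//.
  by rewrite ler_pXn2r ?nnegrE// qnorm_ge0.
by rewrite -mul2n !natrM [2%:R * d%:R]mulrC mulrA [_ * 2%:R]mulrC !mulrA.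
Qed.

End SymbolBound.

(** * Fejer partitions of unity *)

Section Fejer.
Context {R : realType}.
Variable n : nat.
Hypothesis n0 : (0 < n)%N.
Implicit Types (i j : nat) (t : R).
Local Notation root i := (root1 n ^+ i : R[i]).

Let root_neq0 i : root i != 0.
Proof. by rewrite expf_neq0// expi_neq0. Qed.

Let nC0 : n%:R != 0 :> R[i].
Proof. by rewrite pnatr_eq0 -lt0n. Qed.

Definition dirichlet i : {poly R[i]} := \poly_(j < n) (root i ^+ j)^-1.

(* [fejer i] is [(X / root i) ^ (n - 1)] times the square modulus of the
   normalised Dirichlet sum at [root i]: on the circle the moduli of these
   polynomials form a partition of unity concentrated at the [n]-th roots. *)
Definition fejer i : {poly R[i]} :=
  (n%:R ^- 2 * root i ^+ n.-1) *: (dirichlet i * dirichlet i).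

Lemma size_fejer i : (size (fejer i) <= n.*2)%N.
Proof.
rewrite (leq_trans (size_scale_leq _ _))// (leq_trans (size_polyMleq _ _))//.
rewrite -subn1 leq_subLR (leq_trans (leq_add (size_poly _ _) (size_poly _ _)))//.
by rewrite addnn leq_addl.
Qed.

Lemma horner_dirichlet i (z : R[i]) : (dirichlet i).[z] = \sum_(j < n) (z / root i) ^+ j.
Proof.
rewrite horner_poly; apply: eq_bigr => j _.
by rewrite expr_div_n mulrC.
Qed.

(** The term in ['X^(a + b)] carries the factor [root i ^ (n - 1 - a - b)]; summation over [i] keeps
    only [a + b = n - 1], and the [n] such pairs contribute [1 / n] each. *)
Lemma sum_fejer : \sum_(i < n) fejer i = 'X^(n.-1).
Proof.
have H i : fejer i = \sum_(a < n) \sum_(b < n)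
    (n%:R ^- 2 * (root i ^+ (n.-1 - a) / root i ^+ b)) *: 'X^(a + b).
  rewrite /fejer /dirichlet poly_def mulr_suml scaler_sumr.
  apply: eq_bigr => a _; rewrite mulr_sumr scaler_sumr; apply: eq_bigr => b _.
  rewrite -scalerAl -scalerAr !scalerA -exprD; congr (_ *: _).
  have an : (a <= n.-1)%N by rewrite -ltnS prednK.
  rewrite -!mulrA; congr (_ * _); rewrite mulrA; congr (_ * _).
  by rewrite -{1}(subnK an) exprD mulfK// expf_neq0.
under eq_bigr do rewrite H.
rewrite exchange_big /=; transitivity (\sum_(a < n) (n%:R^-1 : R[i]) *: ('X^(n.-1) : {poly R[i]})).
  apply: eq_bigr => a _; rewrite exchange_big /=.
  have an : (a <= n.-1)%N by rewrite -ltnS prednK.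
  have bn : (n.-1 - a < n)%N by rewrite (leq_ltn_trans (leq_subr _ _))// prednK.
  rewrite (bigD1 (Ordinal bn))//= [X in _ + X]big1 ?addr0; last first.
    move=> b ba; rewrite -scaler_suml -mulr_sumr root1_sum// ifF ?mulr0 ?scale0r//.
    by apply: contra_neqF ba => /eqP e; apply: val_inj.
  rewrite -scaler_suml -mulr_sumr root1_sum// eqxx subnKC//; congr (_ *: _).
  by rewrite expr2 invfM -mulrA mulVf// mulr1.
rewrite sumr_const card_ord -scaler_nat scalerA mulfV ?scale1r//.
Qed.

(** On the circle, conjugating the Dirichlet sum multiplies it by a power of [root i / z]. Hence the
    modulus of [fejer i] at [z] is its value divided by [z ^ (n - 1)], a linear expression to which
    [sum_fejer] applies. *)
Lemma sum_nrm_fejer t : \sum_(i < n) nrm ((fejer i).[expi t]) = 1.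
Proof.
have z0 := expi_neq0 t; set z := expi t in z0 *.
apply: (@complexI R); rewrite rmorph_sum/=.
transitivity (\sum_(i < n) z ^- n.-1 * (fejer i).[z]).
  apply: eq_bigr => i _.
  rewrite /fejer hornerZ hornerM cabsM (cabsM (dirichlet i).[z]) -expr2 rmorphM/= -cabs_sqr.
  have -> : nrm (n%:R ^- 2 * root i ^+ n.-1) = (n%:R ^- 2 : R).
    rewrite cabsM !cabsX nrm_expi !expr1n mulr1 cabsV cabsX.
    by rewrite -(rmorph_nat (real_complex R)) cabs_real ger0_norm// exprVn.
  have -> : Num.conj (dirichlet i).[z] = root i ^+ n.-1 * z ^- n.-1 * (dirichlet i).[z].
    rewrite horner_dirichlet rmorph_sum/= mulr_sumr (reindex_inj rev_ord_inj)/=.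
    apply: eq_bigr => j _; rewrite -expr_div_n.
    have -> : Num.conj ((z / root i) ^+ (n - j.+1)) = (root i / z) ^+ (n - j.+1).
      rewrite rmorphXn rmorphM/= expi_conj fmorphV/= rmorphXn/= expi_conj.
      by rewrite exprVn invrK mulrC.
    have jn : (j <= n.-1)%N by rewrite -ltnS prednK.
    have -> : (n - j.+1 = n.-1 - j)%N by rewrite -subn1 -subnDA add1n.
    rewrite -{2}(subnK jn) exprD -mulrA -exprMn.
    have -> : root i / z * (z / root i) = 1 by rewrite mulrA divfK// mulfV.
    by rewrite expr1n mulr1.
  rewrite rmorphV ?unitfE ?expf_neq0 ?pnatr_eq0 -?lt0n// rmorphXn/= rmorph_nat.
  ring.
rewrite -mulr_sumr -(horner_sum _ _ (fun i : 'I_n => fejer i)) sum_fejer hornerXn.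
by rewrite mulVf// expf_neq0.
Qed.

(** The Dirichlet sum is geometric: multiplied by [z / root i - 1] it has modulus at most two,
    whence the four. *)
Lemma fejer_concentrated i t :
  nrm ((fejer i).[expi t]) * nrm (expi t - root i) ^+ 2 <= 4 / n%:R ^+ 2.
Proof.
set z := expi t.
have D : nrm ((dirichlet i).[z]) * nrm (z - root i) <= 2.
  have -> : nrm (z - root i) = nrm (z / root i - 1).
    have -> : z - root i = root i * (z / root i - 1).
      by rewrite mulrBr mulr1 mulrC divfK.
    by rewrite cabsM cabsX nrm_expi expr1n mul1r.
  rewrite -cabsM horner_dirichlet mulrC -subrX1 (le_trans (nrmB _ _))//.
  by rewrite cabsX cabsM cabsV cabsX !nrm_expi expr1n divr1 expr1n cabs1; lra.
rewrite /fejer hornerZ hornerM !cabsM.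
have -> : nrm (root i ^+ n.-1) = 1 by rewrite !cabsX nrm_expi !expr1n.
have -> : nrm (n%:R ^- 2 : R[i]) = (n%:R ^+ 2)^-1.
  by rewrite cabsV cabsX -(rmorph_nat (real_complex R)) cabs_real ger0_norm.
rewrite mulr1 -mulrA mulrC ler_wpM2r ?invr_ge0 ?exprn_ge0//.
have := nrm_ge0 ((dirichlet i).[z]); have := nrm_ge0 (z - root i).
have := mulr_ge0 (nrm_ge0 ((dirichlet i).[z])) (nrm_ge0 (z - root i)).
move: D; set a := nrm _; set b := nrm _ => D ab _ _.
have -> : a * a * b ^+ 2 = (a * b) * (a * b) by ring.
nra.
Qed.

End Fejer.

(** * Gluing along the spectrum of a central unitary *)

Section Patching.
Context {R : realType} {A : cstarAlgType R}.
Variables (I : set A) (v : A).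
Hypotheses (hI : is_ideal [set: A] I) (uv : unitary v).
Hypothesis cv : forall x, I (v ** x - x ** v).
Implicit Types (x y c : A) (z : R[i]) (n N m : nat) (p : {poly R[i]}).
Local Notation q := (qnorm I).
Local Notation T := (act v).

(** The polynomial [p] in [1 + v], applied to [x]. The explicit length [N] lets sums over several
    polynomials become one [laurent] sum. *)
Definition pact N p x := \sum_(k < N) p`_k *: iter k T x.

Lemma pact_sum N (J : Type) (r : seq J) (P : pred J) (p : J -> {poly R[i]}) x :
  pact N (\sum_(i <- r | P i) p i) x = \sum_(i <- r | P i) pact N (p i) x.
Proof.
rewrite exchange_big/=; apply: eq_bigr => k _.
by rewrite coef_sum scaler_suml.
Qed.

Lemma pactB N p x y : pact N p (x - y) = pact N p x - pact N p y.
Proof.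
rewrite -sumrB; apply: eq_bigr => k _.
by rewrite iter_actB scalerBr.
Qed.

Lemma pactD N p x y : pact N p (x + y) = pact N p x + pact N p y.
Proof.
rewrite -big_split/=; apply: eq_bigr => k _.
by rewrite iter_actD scalerDr.
Qed.

Lemma pactXn N n x : (n < N)%N -> pact N 'X^n x = iter n T x.
Proof.
move=> nN; rewrite /pact (bigD1 (Ordinal nN))//= big1 ?addr0.
  by rewrite coefXn eqxx scale1r.
move=> k kn; rewrite coefXn (_ : (k == n :> nat) = false) ?scale0r//.
exact: negbTE.
Qed.

Lemma pact_mulX N p a x : (size p < N)%N ->
  pact N (p * ('X - a%:P)) x = pact N p (T x - a *: x).
Proof.
case: N => // N pN; rewrite pactB; set u := pact _ p (a *: x).
have -> : u = pact N.+1 (a *: p) x.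
  apply: eq_bigr => k _; rewrite iter_actZ coefZ scalerA mulrC //.
rewrite mulrBr mulrC (mulrC p) mul_polyC.
transitivity (pact N.+1 ('X * p) x - pact N.+1 (a *: p) x).
  by rewrite -sumrB; apply: eq_bigr => k _; rewrite coefB scalerBl.
congr (_ - _); rewrite /pact big_ord_recl coefXM eqxx scale0r add0r.
rewrite [RHS]big_ord_recr/= nth_default ?scale0r ?addr0//.
by apply: eq_bigr => k _; rewrite coefXM /= -iterSr.
Qed.

Lemma pact_laurent n N (g : nat -> {poly R[i]}) (s : nat -> A) :
  \sum_(i < n) pact N (g i) (s i) = laurent v (fun k => \sum_(i < n) (g i)`_k *: s i) N.
Proof.
rewrite exchange_big/=; apply: eq_bigr => k _; rewrite iter_act_sum.
by apply: eq_bigr => i _; rewrite iter_actZ.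
Qed.

Lemma symbol_pact n N (g : nat -> {poly R[i]}) (s : nat -> A) z :
  (forall i, (size (g i) <= N)%N) ->
  symbol z (fun k => \sum_(i < n) (g i)`_k *: s i) N = \sum_(i < n) (g i).[z] *: s i.
Proof.
move=> gN; rewrite /symbol; under eq_bigr do rewrite scaler_sumr.
rewrite exchange_big/=; apply: eq_bigr => i _.
rewrite (horner_coef_wide z (gN i)) scaler_suml; apply: eq_bigr => k _.
by rewrite scalerA mulrC.
Qed.

(** At a point of the circle the symbol combines the [s i] with weights whose moduli sum to at most
    one; [laurent_bound] carries this over to the unitary. *)
Lemma pact_bound n N (g : nat -> {poly R[i]}) (s : nat -> A) (C : R) :
  (forall i, (size (g i) <= N)%N) ->
  (forall t, \sum_(i < n) nrm ((g i).[expi t]) <= 1) ->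
  0 <= C -> (forall i, q (s i) <= C) -> q (\sum_(i < n) pact N (g i) (s i)) <= C.
Proof.
move=> gN g1 C0 sC; rewrite pact_laurent; apply: laurent_bound => // t.
rewrite symbol_pact// (le_trans (qnorm_sum hI _ _ _))//.
apply: le_trans (_ : (\sum_(i < n) nrm ((g i).[expi t])) * C <= _); last first.
  by have := g1 t; nra.
by rewrite mulr_suml; apply: ler_sum => i _; rewrite qnormZ// ler_wpM2l ?nrm_ge0.
Qed.

Lemma expi_near (t0 : R) (e : R) : 0 < e ->
  \forall t \near t0, nrm (expi t - expi t0) < e.
Proof.
move=> e0; have e2 : 0 < e / 2 by lra.
have /cvgrPdist_lt/(_ _ e2) hc : cos t @[t --> t0] --> cos t0 by exact: continuous_cos.
have /cvgrPdist_lt/(_ _ e2) hs : sin t @[t --> t0] --> sin t0 by exact: continuous_sin.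
near=> t.
have c1 : `|cos t0 - cos t| < e / 2 by near: t.
have s1 : `|sin t0 - sin t| < e / 2 by near: t.
have -> : expi t - expi t0 =
    (cos t - cos t0)%:C%C + 'i%C * (sin t - sin t0)%:C%C.
  by rewrite /expi; simpc.
rewrite (le_lt_trans (nrmD _ _))// cabsM cabs_i !cabs_real mul1r.
by rewrite distrC (distrC (sin t)); lra.
Unshelve. all: by end_near.
Qed.

(* Compactness of the circle: each datum at [t0] stays valid near [t0]. *)
Lemma uniform_local_data (S : set A) c (e : R) :
  (forall t, exists s x, S s /\ q (c - s - (T x - expi t *: x)) < e) ->
  exists2 m : nat, (0 < m)%N & forall t, 0 <= t <= pi *+ 2 ->
    exists s x, [/\ S s, nrm x <= m%:R & q (c - s - (T x - expi t *: x)) <= e - m%:R^-1].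
Proof.
move=> H.
(* One integer [m] bounds the size of [x] and leaves the margin [1 / m]. Both demands weaken as [m]
   grows, as needed for a covering along the filter at infinity. *)
pose P (m : nat) t := (0 < m)%N /\ exists s x,
  [/\ S s, nrm x <= m%:R & q (c - s - (T x - expi t *: x)) <= e - m%:R^-1].
have /compact_near_coveringP cpt := @segment_compact R 0 (pi *+ 2).
have /= := cpt nat \oo P _; case=> [t0 _|N _ HN].
  have [s [x [Ss xe]]] := H t0; set e0 := q _ in xe.
  have d0 : 0 < (e - e0) / 2 by lra.
  have X0 : 0 < nrm x + 1 by rewrite ltr_wpDl// nrm_ge0.
  exists ([set t | nrm (expi t - expi t0) < (e - e0) / 2 / (nrm x + 1)],
          [set m : nat | nrm x + ((e - e0) / 2)^-1 <= m%:R]).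
    split => /=; first by apply: expi_near; rewrite divr_gt0.
    exists (Num.bound (nrm x + ((e - e0) / 2)^-1)) => // m /= Nm.
    apply: ltW; apply: lt_le_trans (archi_boundP _) _; last by rewrite ler_nat.
    by rewrite addr_ge0 ?nrm_ge0// invr_ge0 ltW.
  case=> t m /= [tt0 hm].
  have di : 0 < ((e - e0) / 2)^-1 by rewrite invr_gt0.
  have m0 : 0 < m%:R :> R by have := nrm_ge0 x; lra.
  split; first by rewrite -(ltr0n R).
  exists s, x; split=> //; first lra.
  have -> : c - s - (T x - expi t *: x) =
      (c - s - (T x - expi t0 *: x)) + (expi t - expi t0) *: x by lmod R[i].
  rewrite (le_trans (qnormD hI _ _))// -/e0 qnormZ//.
  have : m%:R^-1 <= (e - e0) / 2.
    rewrite -[leRHS]invrK lef_pV2 ?posrE//; have := nrm_ge0 x; lra.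
  move: tt0; rewrite ltr_pdivlMr// => tt0.
  have := qnorm_le_nrm hI x; have := qnorm_ge0 hI x; have := nrm_ge0 (expi t - expi t0).
  have := nrm_ge0 x; set a := nrm (expi t - _) in tt0 *; set b := qnorm I x; nra.
have [M [M0 hM]] : exists M : nat, (N <= M)%N /\ (0 < M)%N.
  by exists N.+1; rewrite leqnSn.
exists M => // t tt; have [] // := HN M M0 t.
Qed.

(* Partitioning unity along the spectrum of the central unitary [1 + v] glues
   local approximations of [c], without loss in the error. *)
Lemma patch (S : set A) c (e : R) :
  (forall t, exists s x, S s /\ q (c - s - (T x - expi t *: x)) < e) ->
  exists n N (g : nat -> {poly R[i]}) (s : nat -> A),
    [/\ forall i, (size (g i) <= N)%N,
        forall t, \sum_(i < n) nrm ((g i).[expi t]) <= 1,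
        forall i, S (s i) &
        q (iter n.-1 T c - \sum_(i < n) pact N (g i) (s i)) < e].
Proof.
move=> /uniform_local_data[m m0 Hm].
(* The final error bound is [e - 1 / m + m r + 4 m / (r n)] with [r = 1 / (4 m ^ 2)]; this [n] makes
   each of the last two terms [1 / (4 m)]. *)
pose n := (64 * m ^ 4)%N; have n0 : (0 < n)%N by rewrite muln_gt0 expn_gt0 m0.
have mR : 0 < m%:R :> R by rewrite ltr0n.
pose ang i : R := (i %% n)%:R * (pi *+ 2 / n%:R).
have p0 : 0 < pi *+ 2 :> R by rewrite pmulrn_lgt0//; exact: pi_gt0.
have nR : 0 < n%:R :> R by rewrite ltr0n.
have rootE i : root1 n ^+ i = expi (ang i).
  rewrite -root1_exp; have := prim_expr_mod (root1_prim (R := R) n0) i.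
  by move=> ->.
have /choice[d Hd] : forall i, exists d : A * A, [/\ S d.1, nrm d.2 <= m%:R &
    q (c - d.1 - (T d.2 - root1 n ^+ i *: d.2)) <= e - m%:R^-1].
  move=> i; have [|s [x Hsx]] := Hm (ang i); last by exists (s, x); rewrite rootE.
  rewrite /ang; apply/andP; split; first by rewrite mulr_ge0// divr_ge0// ltW.
  rewrite mulrCA ger_pMr// ler_pdivrMr// mul1r ler_nat ltnW// ltn_mod//.
pose N := n.*2.+1.
exists n, N, (fejer n), (fun i => (d i).1); split.
- by move=> i; rewrite (leq_trans (size_fejer _ _))// leqnSn.
- by move=> t; rewrite sum_nrm_fejer.
- by move=> i; have [] := Hd i.
pose E i := c - (d i).1 - (T (d i).2 - root1 n ^+ i *: (d i).2).
have nN : (n.-1 < N)%N by rewrite /N ltnS -addnn (leq_trans (leq_pred _))// leq_addl.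
(* Besides the local errors [E i], what remains is [fejer n i] times a linear factor vanishing at
   the [i]-th root: small near the root by this factor, elsewhere by concentration. *)
have -> : iter n.-1 T c - \sum_(i < n) pact N (fejer n i) (d i).1 =
   laurent v (fun k => \sum_(i < n) (fejer n i)`_k *: E i +
     \sum_(i < n) (fejer n i * ('X - (root1 n ^+ i)%:P))`_k *: (d i).2) N.
  have -> : forall w1 w2 : nat -> A, laurent v (fun k => w1 k + w2 k) N = laurent v w1 N + laurent v w2 N.
    move=> w1 w2; rewrite -big_split; apply: eq_bigr => k _; exact: iter_actD.
  rewrite -(pact_laurent _ _ (fejer n) E).
  rewrite -(pact_laurent _ _ (fun i => fejer n i * ('X - (root1 n ^+ i)%:P)) (fun i => (d i).2)).
  rewrite -(pactXn c nN) -(sum_fejer n0) pact_sum -sumrB -big_split.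
  apply: eq_bigr => i _ /=.
  rewrite pact_mulX; last by rewrite ltnS size_fejer.
  by rewrite -pactB -pactD /E subrK.
apply: le_lt_trans (_ : e - m%:R^-1 + 2^-1 * m%:R^-1 < _); last first.
  by have : 0 < m%:R^-1 :> R; [rewrite invr_gt0|lra].
apply: laurent_bound => // t; set z := expi t.
have -> : symbol z (fun k => \sum_(i < n) (fejer n i)`_k *: E i +
     \sum_(i < n) (fejer n i * ('X - (root1 n ^+ i)%:P))`_k *: (d i).2) N =
   \sum_(i < n) (fejer n i).[z] *: (E i + (z - root1 n ^+ i) *: (d i).2).
  have -> : forall w1 w2 : nat -> A, symbol z (fun k => w1 k + w2 k) N = symbol z w1 N + symbol z w2 N.
    move=> w1 w2; rewrite /symbol.
    rewrite -big_split; apply: eq_bigr => k _; exact: scalerDr.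
  rewrite (symbol_pact _ (g := fejer n)); last first.
    by move=> i; rewrite (leq_trans (size_fejer _ _))// leqnSn.
  rewrite (symbol_pact _ (g := fun i => fejer n i * ('X - (root1 n ^+ i)%:P))
    (fun i => (d i).2)); last first.
    move=> i; rewrite (leq_trans (size_polyMleq _ _))// size_XsubC addn2/=.
    by rewrite ltnS size_fejer.
  rewrite -big_split; apply: eq_bigr => i _ /=.
  by rewrite hornerM hornerXsubC -scalerA -scalerDr.
rewrite (le_trans (qnorm_sum hI _ _ _))//.
pose a i := nrm ((fejer n i).[z]); pose b i := nrm (z - root1 n ^+ i).
pose r : R := (4 * m%:R ^+ 2)^-1.
have r0 : 0 < r by rewrite invr_gt0 mulr_gt0// exprn_gt0.
apply: le_trans (_ : \sum_(i < n) (a i * (e - m%:R^-1 + m%:R * r) +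
   m%:R / r * (4 / n%:R ^+ 2)) <= _).
  apply: ler_sum => i _; rewrite qnormZ// -/(a i).
  have [_ dm Ee] := Hd i; rewrite -/(E i) in Ee.
  apply: le_trans (_ : a i * (e - m%:R^-1 + m%:R * b i) <= _).
    rewrite ler_wpM2l ?nrm_ge0// (le_trans (qnormD hI _ _))// lerD// qnormZ// mulrC.
    by rewrite ler_wpM2r ?nrm_ge0// (le_trans (qnorm_le_nrm hI _)).
  (* Trades the distance to the root for its square, which [fejer_concentrated] controls. *)
  have bb : b i <= r + b i ^+ 2 / r.
    rewrite -(ler_pM2r r0) mulrDl divfK ?gt_eqF//.
    have := nrm_ge0 (z - root1 n ^+ i); rewrite -/(b i); nra.
  have := fejer_concentrated n i t; rewrite -/z -/(a i) -/(b i) => ab.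
  have a0 : 0 <= a i := nrm_ge0 _.
  have mr : 0 <= m%:R / r by rewrite divr_ge0 ?ltW.
  apply: le_trans (_ : a i * (e - m%:R^-1 + m%:R * (r + b i ^+ 2 / r)) <= _).
    by rewrite ler_wpM2l// lerD2l ler_wpM2l// ltW.
  have := ler_wpM2l mr ab.
  have -> : m%:R / r * (a i * b i ^+ 2) = a i * (m%:R * (b i ^+ 2 / r)) by ring.
  set B := b i ^+ 2 / r; set D := 4 / _ => H.
  have -> : a i * (e - m%:R^-1 + m%:R * (r + B)) =
      a i * (e - m%:R^-1 + m%:R * r) + a i * (m%:R * B) by ring.
  by rewrite lerD2l.
rewrite big_split/= -mulr_suml sum_nrm_fejer// mul1r sumr_const card_ord.
rewrite -addrA lerD2l -[X in _ + X <= _]mulr_natr.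
have nE : n%:R = 64 * m%:R ^+ 4 :> R by rewrite natrM natrX.
rewrite /r nE le_eqVlt; apply/orP; left; apply/eqP.
field.
by rewrite gt_eqF.
Qed.

End Patching.

(** * Maximal ideals and characters *)

Section MaximalIdeals.
Context {R : realType} {A : cstarAlgType R}.
Implicit Types (x y z a b d : A) (c : R[i]) (S I B K L M X F : set A) (e : R).

Definition algebraic_ideal X :=
  subspace X /\ forall a x, X x -> X (a ** x) /\ X (x ** a).

Lemma ideal_algebraic I : is_ideal [set: A] I -> algebraic_ideal I.
Proof.
move=> hI; split; first exact: ideal_subspace hI.
by move=> a x Ix; split; [exact: idealMl|exact: idealMr].
Qed.

Lemma subset_adherent X : X `<=` adherent X.
Proof. by move=> x Xx e e0; exists x; rewrite // subrr nrm0. Qed.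

Lemma adherent_ideal X : algebraic_ideal X -> is_ideal [set: A] (adherent X).
Proof.
move=> [[X0 XD XZ] XM]; have XB := @subset_adherent X.
have lip (f : A -> A) (r : R) x : 0 <= r ->
    (forall y, X y -> X (f y)) -> (forall y, nrm (f x - f y) <= r * nrm (x - y)) ->
    adherent X x -> adherent X (f x).
  move=> r0 Xf fr Xx e e0; have r1 : 0 < r + 1 by lra.
  have [y Xy] := Xx _ (divr_gt0 e0 r1); rewrite ltr_pdivlMr// => xy.
  exists (f y); [exact: Xf|].
  by have := fr y; have := nrm_ge0 (x - y); nra.
split=> //.
- apply/submod_closedP; split; first exact: XB.
    move=> x y Xx Xy e e0; have e2 : 0 < e / 2 by lra.
    have [x' Xx' xx'] := Xx _ e2; have [y' Xy' yy'] := Xy _ e2.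
    exists (x' + y'); first exact: XD.
    by rewrite opprD addrACA (le_lt_trans (nrmD _ _))//; lra.
  move=> c x; apply: (lip (fun x => c *: x) (nrm c)) => [|y|y]; first exact: nrm_ge0.
    exact: XZ.
  by rewrite -scalerBr nrmZ.
- apply/closed_adherent => x Xx e e0; have e2 : 0 < e / 2 by lra.
  have [y Xy xy] := Xx _ e2; have [z Xz yz] := Xy _ e2.
  exists z => //; rewrite -(subrK y x) -addrA (le_lt_trans (nrmD _ _))//.
  lra.
- move=> a x _ Xx; split.
    apply: (lip (fun x => a ** x) (nrm a)) => [|y Xy|y|//]; first exact: nrm_ge0.
      by have [] := XM a y Xy.
    by rewrite -cmulBr nrmM.
  apply: (lip (fun x => x ** a) (nrm a)) => [|y Xy|y|//]; first exact: nrm_ge0.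
    by have [] := XM a y Xy.
  by rewrite -cmulBl mulrC nrmM.
Qed.

Lemma qnorm_adherent X e x : algebraic_ideal X ->
  (forall y, X y -> e <= nrm (x - y)) -> e <= qnorm (adherent X) x.
Proof.
move=> hX H; rewrite leNgt; apply/negP => /(qnorm_lt (adherent_ideal hX))[y Xy xy].
have [|z Xz yz] := Xy (e - nrm (x - y)); first lra.
have := H _ Xz; rewrite leNgt => /negP; apply.
by rewrite -(subrK y x) -addrA (le_lt_trans (nrmD _ _))//; lra.
Qed.

(** The distance condition passes to unions of chains of ideals, not necessarily closed, and then to
    closures, so that a maximal one is closed. [F] is a set in order to hold either one element or
    all the differences [c - z]. *)
Lemma maximal_ideal B K F e : is_ideal [set: A] B -> is_ideal [set: A] K ->
  K `<=` B -> (forall f, F f -> e <= qnorm K f) ->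
  exists L, [/\ is_ideal [set: A] L, K `<=` L, L `<=` B,
    forall f, F f -> e <= qnorm L f &
    forall L', is_ideal [set: A] L' -> L `<=` L' -> L' `<=` B ->
      (forall f, F f -> e <= qnorm L' f) -> L' = L].
Proof.
move=> hB hK KB eK.
pose good X := [/\ algebraic_ideal X, K `<=` X, X `<=` B &
  forall f y, F f -> X y -> e <= nrm (f - y)].
have goodI L : is_ideal [set: A] L -> K `<=` L -> L `<=` B ->
    (forall f, F f -> e <= qnorm L f) -> good L.
  move=> hL KL LB eL; split=> //; first exact: ideal_algebraic.
  by move=> f y Ff Ly; rewrite (le_trans (eL f Ff))// qnorm_lb.
have [|L [PL maxL]] := @Zorn_bigcup A [set X | X = set0 \/ good X].
  move=> C CP tC.
  have [C0|/existsNP[X0 /not_implyP[CX0 X0n]]] :=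
      pselect (forall X, C X -> X = set0).
    by left; apply/seteqP; split => // x [X /C0 ->].
  right; have G X x : C X -> X x -> good X.
    by move=> /CP[->|].
  have GX0 : good X0 by case: (CP _ CX0).
  have two x y : (\bigcup_(X in C) X) x -> (\bigcup_(X in C) X) y ->
      exists X, [/\ C X, X x & X y].
    move=> [X CX Xx] [Y CY Yy].
    by have [XY|YX] := tC X Y CX CY; [exists Y|exists X]; split=> //; [exact: XY|exact: YX].
  split.
  - split.
      split.
      + by exists X0 => //; have [[[]]] := GX0.
      + move=> x y Cx Cy; have [X [CX Xx Xy]] := two _ _ Cx Cy.
        by exists X => //; have [[[_ XD _] _] _ _ _] := G _ _ CX Xx; apply: (XD).
      + move=> c x [X CX Xx]; exists X => //.
        by have [[[_ _ XZ] _] _ _ _] := G _ _ CX Xx; apply: (XZ).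
    move=> a x [X CX Xx]; have [[_ XM] _ _ _] := G _ _ CX Xx.
    by have [] := XM a x Xx; split; exists X.
  - by move=> x Kx; exists X0 => //; have [_ + _ _] := GX0; apply.
  - by move=> x [X CX Xx]; have [_ _ + _] := G _ _ CX Xx; apply.
  - by move=> f y Ff [X CX Xy]; have [_ _ _ +] := G _ _ CX Xy; apply.
have K0 : K 0 by have [] := ideal_subspace hK.
have GL : good L.
  case: PL => // L0; exfalso; apply: (maxL K); last by right; apply: goodI.
  by rewrite L0; split=> // /(_ _ K0).
have maxL' X : good X -> L `<=` X -> X = L.
  move=> GX LX; apply: contrapT => XL; apply: (maxL X); last by right.
  by split=> // XL'; apply: XL; apply/seteqP.
have [aL KL LB eL] := GL.
have clL : adherent L = L.
  apply: maxL'; last exact: subset_adherent.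
  apply: goodI; first exact: adherent_ideal.
  - by apply: subset_trans KL _; apply: subset_adherent.
  - move=> x Lx; apply: (ideal_adherent hB) => r /Lx[y /LB By xy].
    by exists y.
  - by move=> f Ff; apply: qnorm_adherent => // y Ly; apply: eL.
have hL : is_ideal [set: A] L by rewrite -clL; apply: adherent_ideal.
exists L; split=> // [f Ff|L' hL' LL' L'B eL'].
  by rewrite -clL; apply: qnorm_adherent => // y Ly; apply: eL.
by apply: maxL' => //; apply: goodI => //; apply: subset_trans LL'.
Qed.

Definition central_mod I x := forall y, I (x ** y - y ** x).

Lemma central_mod_subalgebra I : is_ideal [set: A] I ->
  closed_subalgebra (central_mod I).
Proof.
move=> hI; have [I0 ID IZ] := ideal_subspace hI; split.
- split=> [y|x y cx cy z|c x cx y].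
  + by rewrite cmul0l cmul0r subrr.
  + by rewrite cmulDl cmulDr opprD addrACA; apply: (ID).
  + by rewrite cmulZl cmulZr -scalerBr; apply: (IZ).
- apply/closed_adherent => x cx y; apply: (ideal_adherent hI) => e e0.
  have d0 : 0 < 2 * (nrm y + 1) by have := nrm_ge0 y; lra.
  have [z cz] := cx _ (divr_gt0 e0 d0); rewrite ltr_pdivlMr// => xz.
  exists (z ** y - y ** z); first exact: cz.
  have -> : x ** y - y ** x - (z ** y - y ** z) = (x - z) ** y - y ** (x - z).
    by rewrite cmulBl cmulBr; lmod R[i].
  rewrite (le_lt_trans (nrmB _ _))//.
  have := nrmM (x - z) y; have := nrmM y (x - z).
  have := nrm_ge0 y; have := nrm_ge0 (x - z); nra.
- move=> x y cx cy z.
  have -> : x ** y ** z - z ** (x ** y) =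
      x ** (y ** z - z ** y) + (x ** z - z ** x) ** y.
    by rewrite cmulBl cmulBr !cmulA; lmod R[i].
  by apply: (ID); [exact: idealMl|exact: idealMr].
Qed.

Lemma central_mod_star I x : is_ideal [set: A] I -> central_mod I x ->
  central_mod I (cstar x).
Proof.
move=> hI cx y; have -> : cstar x ** y - y ** cstar x =
    cstar (- (x ** cstar y - cstar y ** x)).
  by rewrite cstarN cstarB !cstarM cstarK opprB.
apply: ideal_starT => //; apply: subspaceN => //; exact: ideal_subspace hI.
Qed.

Lemma central_mod_subset I L : I `<=` L -> central_mod I `<=` central_mod L.
Proof. by move=> IL x cx y; apply: IL. Qed.

Lemma ideal_within B I : is_ideal [set: A] I -> I `<=` B -> is_ideal B I.
Proof. by move=> [_ ? ? IM] IB; split=> // b x _; apply: IM. Qed.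

Section SpectralIdeal.
Variables (B I : set A) (v : A) (z : R[i]).
Hypotheses (hB : is_ideal [set: A] B) (hI : is_ideal [set: A] I) (IB : I `<=` B).
Hypothesis cv : central_mod I v.

(* [adherent spectral] is the ideal generated in [B] by [I] and [(1 + v) - z]. *)
Definition spectral : set A :=
  [set u | exists y x, [/\ I y, B x & u = y + (act v x - z *: x)]].

Lemma spectral_ideal : algebraic_ideal spectral.
Proof.
have [I0 ID IZ] := ideal_subspace hI; have [B0 BD BZ] := ideal_subspace hB.
split.
  split.
  - by exists 0, 0; split=> //; rewrite /act cmul0r scaler0 subr0 !addr0.
  - move=> _ _ [y [x [Iy Bx ->]]] [y' [x' [Iy' Bx' ->]]].
    exists (y + y'), (x + x'); split; [exact: ID|exact: BD|].
    by rewrite /act cmulDr; lmod R[i].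
  - move=> c _ [y [x [Iy Bx ->]]].
    exists (c *: y), (c *: x); split; [exact: IZ|exact: BZ|].
    by rewrite /act cmulZr; lmod R[i].
move=> a _ [y [x [Iy Bx ->]]]; split.
  exists (a ** y - (v ** a - a ** v) ** x), (a ** x); split.
  - apply: subspaceB; first exact: ideal_subspace hI.
      exact: idealMl.
    by apply: idealMr => //; apply: cv.
  - exact: idealMl.
  - by rewrite /act cmulDr cmulBr cmulDr cmulZr cmulBl !cmulA; lmod R[i].
exists (y ** a), (x ** a); split; [exact: idealMr|exact: idealMr|].
by rewrite /act cmulDl cmulBl cmulDl cmulZl cmulA.
Qed.

Lemma spectral_sub : B v -> adherent spectral `<=` B.
Proof.
move=> Bv u Su; apply: (ideal_adherent hB) => e /Su[w [y [x [Iy Bx ->]]] uw].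
exists (y + (act v x - z *: x)) => //.
have [B0 BD BZ] := ideal_subspace hB.
apply: (BD); first exact: IB.
apply: subspaceB; first exact: ideal_subspace hB.
  by apply: (BD) => //; apply: idealMl.
exact: BZ.
Qed.

Lemma sub_spectral : I `<=` adherent spectral.
Proof.
move=> y Iy; apply: subset_adherent; exists y, 0; split=> //.
  by have [] := ideal_subspace hB.
by rewrite /act cmul0r scaler0 subr0 !addr0.
Qed.

Lemma spectral_mem x : B x -> adherent spectral (act v x - z *: x).
Proof.
move=> Bx; apply: subset_adherent; exists 0, x; split=> //; last by rewrite add0r.
by have [] := ideal_subspace hI.
Qed.

End SpectralIdeal.

Lemma coset_eq M a b : subspace M -> M (a - b) -> coset M a = coset M b.
Proof.
move=> sM Mab; apply/seteqP; split=> x /= Mx; have [_ MD _] := sM.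
  by have := MD _ _ Mx Mab; rewrite addrA subrK.
by have := subspaceB sM Mx Mab; rewrite opprB addrA subrK.
Qed.

Lemma quot_mul_coset M a b : is_ideal [set: A] M ->
  quot_mul M (coset M a) (coset M b) = coset M (a ** b).
Proof.
move=> hM; have [M0 MD MZ] := ideal_subspace hM; apply/seteqP; split.
  move=> c [x [y [/= Mx My /= Mc]]]; rewrite /coset/=.
  have -> : c - a ** b = (c - x ** y) + (x ** (y - b) + (x - a) ** b).
    by rewrite cmulBl cmulBr; lmod R[i].
  by apply: (MD) => //; apply: (MD); [exact: idealMl|exact: idealMr].
by move=> c /= Mc; exists a, b; rewrite /coset/= !subrr.
Qed.

(** [d / l] is a unit modulo [M]. A strictly larger [K] contains some [y] for which
    [w = (d - y) / l] has norm below one and acts on [B] as the identity modulo [K]; so each [x] in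
    [B] is congruent to [w ^ n x], which tends to zero. *)
Lemma max_criterion B M d (l : R[i]) : is_ideal [set: A] B ->
  is_ideal [set: A] M -> M `<=` B -> B d -> ~ M d -> central_mod M d -> l != 0 ->
  (forall x, B x -> M (d ** x - l *: x)) ->
  (forall K, is_ideal [set: A] K -> M `<=` K -> K `<=` B -> K <> M ->
     exists2 y, K y & nrm (d - y) < nrm l) ->
  Max B M.
Proof.
move=> hB hM MB Bd Md cd l0 dl near.
have sM := ideal_subspace hM; have [M0 MD MZ] := sM.
have [_ BD BZ] := ideal_subspace hB.
have ul x : B x -> M ((l^-1 *: d) ** x - x).
  move=> Bx; have -> : (l^-1 *: d) ** x - x = l^-1 *: (d ** x - l *: x).
    by rewrite cmulZl scalerBr scalerA mulVf// scale1r.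
  by apply: (MZ); apply: dl.
split; first exact: ideal_within.
- exists (coset M (l^-1 *: d)); first by exists (l^-1 *: d) => //; apply: (BZ).
  move=> _ [b Bb <-]; rewrite !quot_mul_coset//; split; apply: coset_eq => //.
    exact: ul.
  have -> : b ** (l^-1 *: d) - b =
      ((l^-1 *: d) ** b - b) - l^-1 *: (d ** b - b ** d).
    by rewrite cmulZl cmulZr; lmod R[i].
  by apply: subspaceB => //; [exact: ul|exact/MZ/cd].
- by move=> MB'; apply: Md; rewrite MB'.
move=> K hK MK; have hK' := ideal_trans hB hK.
have KB : K `<=` B by case: hK.
have [KM|KM] := pselect (K = M); [by left|right; apply/seteqP; split=> // x Bx].
have [y Ky dy] := near K hK' MK KB KM.
have sK := ideal_subspace hK'; have [K0 KD KZ] := sK.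
pose w := l^-1 *: (d - y).
have n0 : 0 < nrm l.
  by rewrite lt_neqAle nrm_ge0 andbT eq_sym; apply: contra_neq l0 => /nrm0_eq0.
have w1 : nrm w < 1 by rewrite nrmZ cabsV mulrC ltr_pdivrMr// mul1r.
have step u : B u -> K (u - w ** u).
  move=> Bu; have -> : u - w ** u = (l^-1 *: y) ** u - ((l^-1 *: d) ** u - u).
    by rewrite /w scalerBr cmulBl !opprB addrCA.
  by apply: subspaceB => //; [apply: idealMr => //; exact: KZ|apply/MK/ul].
pose W n := iter n (cmul w) x.
have BW n : B (W n).
  by elim: n => //= n IH; apply: idealMl.
have KW n : K (x - W n).
  elim: n => [|n IH]; first by rewrite subrr.
  by have := KD _ _ IH (step _ (BW n)); rewrite addrA subrK.
have W0 n : nrm (W n) <= nrm w ^+ n * nrm x.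
  elim: n => [|n IH]; first by rewrite expr0 mul1r.
  by rewrite (le_trans (nrmM _ _))// exprS -mulrA ler_wpM2l// nrm_ge0.
apply: (ideal_adherent hK') => e e0.
have x1 : 0 < nrm x + 1 by rewrite ltr_wpDl// nrm_ge0.
have /cvgrPdist_lt /(_ _ (divr_gt0 e0 x1)) : nrm w ^+ n @[n --> \oo] --> (0 : R).
  by apply: cvg_expr; rewrite ger0_norm// nrm_ge0.
move=> [N _ /(_ N (leqnn _))] /=; rewrite sub0r normrN.
rewrite ger0_norm ?exprn_ge0 ?nrm_ge0// ltr_pdivlMr// => HN.
exists (x - W N); first exact: KW.
rewrite opprB addrC subrK (le_lt_trans (W0 N))//; apply: le_lt_trans HN.
by rewrite ler_wpM2l ?exprn_ge0 ?nrm_ge0// lerDl.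
Qed.

(** At an ideal [L] maximal for the distance [e] to [d], the Cayley transform of [d] must act as a
    scalar, hence so does [d]. The modulus of its scalar [l] is the quotient norm of [d], at least
    [e], while every larger ideal comes closer than [e] to [d], as [max_criterion] requires. *)
Lemma exists_character_small B I d : is_ideal [set: A] B -> is_ideal [set: A] I ->
  I `<=` B -> B d -> cstar d = d -> central_mod I d -> ~ I d -> nrm d < 1 ->
  exists M l, [/\ Max B M, I `<=` M, l != 0, ~ M d &
    forall x, B x -> M (d ** x - l *: x)].
Proof.
move=> hB hI IB Bd ds cd Id d1.
have [v [uv ev ev' Sv]] := cayley ds d1.
pose e := qnorm I d; have e0 : 0 < e by apply: qnorm_gt0.
have [|L [hL IL LB eL maxL]] := @maximal_ideal B I [set d] e hB hI IB.
  by move=> _ ->.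
have {}eL : e <= qnorm L d by apply: eL.
have sL := ideal_subspace hL; have [L0 LD LZ] := sL.
have Ld : ~ L d by move=> Ld; move: eL; rewrite (qnorm_mem hL Ld); lra.
have cdL : central_mod L d by apply: central_mod_subset cd.
have cvL : central_mod L v by apply: Sv cdL; apply: central_mod_subalgebra.
have Bv : B v by apply: Sv Bd; apply: ideal_subalgebra hB.
(* Otherwise [patch], with [0] as the only approximant, would bring [d] times a power of the
   unitary, hence [d], within less than [e] of [L]. *)
have [t Ht] : exists t, forall x, B x -> e <= qnorm L (d - (act v x - expi t *: x)).
  apply: contrapT => /forallNP H.
  have [|n [N [g [s [gN g1 s0]]]]] := @patch _ _ L v hL uv cvL [set 0] d e.
    move=> t; have /existsNP[x /not_implyP[Bx /negP]] := H t.
    by rewrite -ltNge => xe; exists 0, x; rewrite subr0.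
  rewrite big1 => [|i _].
    by rewrite subr0 qnorm_iter_act// ltNge eL.
  by rewrite s0 /pact big1// => k _; rewrite iter_act0 scaler0.
set z := expi t in Ht.
have aS : algebraic_ideal (spectral B L v z) by apply: spectral_ideal.
have SL : adherent (spectral B L v z) = L.
  apply: maxL; first exact: adherent_ideal.
  - exact: sub_spectral.
  - exact: spectral_sub.
  - move=> _ ->; apply: qnorm_adherent => // _ [y [x [Ly Bx ->]]].
    have -> : d - (y + (act v x - z *: x)) = d - (act v x - z *: x) - y by lmod R[i].
    by rewrite (le_trans (Ht x Bx))// qnorm_lb.
have vz x : B x -> L (v ** x - (z - 1) *: x).
  move=> Bx; rewrite -SL (_ : _ - _ = act v x - z *: x); first exact: spectral_mem.
  by rewrite /act; lmod R[i].
have dz x : B x -> L ((z - 1) *: x - ('i%C * (z + 1)) *: (d ** x)).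
  move=> Bx.
  have -> : (z - 1) *: x - ('i%C * (z + 1)) *: (d ** x) =
      'i%C *: (d ** (v ** x - (z - 1) *: x)) - (v ** x - (z - 1) *: x).
    rewrite {2}ev cmulDl !cmulZl cmulBr cmulZr cmulA; lmod R[i].
  by apply: subspaceB => //; [apply: (LZ); apply: idealMl => //; apply: vz|exact: vz].
have z1 : z + 1 != 0.
  apply/eqP => ez; apply: Ld; have := dz d Bd.
  rewrite ez mulr0 scale0r subr0.
  have -> : z - 1 = - 2 by rewrite -(addrK 1 z) ez; ring.
  have n2 : (- 2 : R[i]) != 0 by rewrite oppr_eq0 pnatr_eq0.
  by move=> /(LZ (- 2)^-1); rewrite scalerA mulVf// scale1r.
have i0 : 'i%C != 0 :> R[i] by rewrite eq_complex/= oner_eq0 andbF.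
(* The inverse Cayley transform of [z]. *)
pose l := (z - 1) / ('i%C * (z + 1)).
have dl x : B x -> L (d ** x - l *: x).
  move=> Bx; have k0 : 'i%C * (z + 1) != 0 by rewrite mulf_neq0.
  have := LZ (- ('i%C * (z + 1))^-1) _ (dz x Bx).
  rewrite scalerBr !scalerA !mulNr mulVf// (mulrC _^-1) -/l.
  by rewrite scaleN1r opprK addrC scaleNr.
have qd : e <= nrm l.
  have : qnorm L d ^+ 2 = nrm l * qnorm L d.
    rewrite -qnorm_sqr// ds -qnormZ//; apply: qnorm_congr => //; exact: dl.
  have : 0 < qnorm L d by lra.
  by rewrite expr2 => q0 /(mulIf (lt0r_neq0 q0)) <-.
have l0 : l != 0 by apply/eqP => l0; move: qd; rewrite l0 nrm0; lra.
exists L, l; split=> //.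
apply: (@max_criterion B L d l) => // K hK LK KB KL.
apply: contrapT => nK; apply: KL; apply: maxL => // _ ->.
rewrite leNgt; apply/negP => /(qnorm_lt hK)[y Ky dy].
by apply: nK; exists y => //; apply: lt_le_trans qd.
Qed.

Lemma exists_character B I d : is_ideal [set: A] B -> is_ideal [set: A] I ->
  I `<=` B -> B d -> cstar d = d -> central_mod I d -> ~ I d ->
  exists M l, [/\ Max B M, I `<=` M, l != 0, ~ M d &
    forall x, B x -> M (d ** x - l *: x)].
Proof.
move=> hB hI IB Bd ds cd Id; have [t t0 td] := scale_lt1 d.
have tC : t%:C%C != 0 :> R[i] by rewrite eq_complex/= eqxx andbT gt_eqF.
have [_ _ BZ] := ideal_subspace hB; have [_ _ IZ] := ideal_subspace hI.
have [||||//|M [l [MM IM l0 Md Ml]]] := @exists_character_small B I (t%:C%C *: d) hB hI IB.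
- exact: BZ.
- by rewrite cstarZ ds; congr (_ *: _); exact: conjc_real.
- by have [[_ _ CZ] _ _] := central_mod_subalgebra hI; apply: (CZ).
- by move=> /(IZ (t%:C%C)^-1); rewrite scalerA mulVf// scale1r.
have [hM _ _ _] := MM; have hM' := ideal_trans hB hM.
have [_ _ MZ] := ideal_subspace hM'.
exists M, ((t%:C%C)^-1 * l); split=> //.
- by rewrite mulf_neq0// invr_eq0.
- by move=> Md'; apply: Md; apply: (MZ).
move=> x Bx; have := MZ (t%:C%C)^-1 _ (Ml x Bx).
by rewrite cmulZl scalerBr !scalerA mulVf// scale1r.
Qed.

End MaximalIdeals.

(** * Weakly central ideals *)

Section WeaklyCentral.
Context {R : realType} {A : cstarAlgType R}.
Implicit Types (x y z a b c d h v : A) (l mu : R[i]) (S I B K L M X F : set A) (e : R).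

Lemma real_imaginary x : exists a b, [/\ cstar a = a, cstar b = b,
  x = a + 'i%C *: b &
  forall S, subspace S -> S x -> S (cstar x) -> S a /\ S b].
Proof.
have two : Num.conj (2^-1 : R[i]) = 2^-1 by rewrite fmorphV/= conjC_nat.
have conj_i : Num.conj 'i%C = - 'i%C :> R[i] by rewrite complexiE conjCi.
have ii : 'i%C * 'i%C = -1 :> R[i] by rewrite -expr2 sqr_i.
have twoV : 2^-1 + 2^-1 = 1 :> R[i] by field.
exists (2^-1 *: (x + cstar x)), ((- 'i%C * 2^-1) *: (x - cstar x)); split.
- by rewrite cstarZ cstarD cstarK two addrC.
- rewrite cstarZ cstarB cstarK rmorphM rmorphN/= two conj_i.
  by rewrite -opprB scalerN -scaleNr mulNr opprK.
- rewrite scalerA mulrA mulrN ii opprK mul1r -scalerDr addrACA subrr addr0.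
  by rewrite scalerDr -scalerDl twoV scale1r.
- move=> S sS Sx Sx'; have [_ SD SZ] := sS.
  by split; apply: SZ; [exact: SD|exact: subspaceB].
Qed.

Lemma ideal_real_imaginary I x a b : is_ideal [set: A] I ->
  x = a + 'i%C *: b -> I a -> I b -> I x.
Proof.
by move=> /ideal_subspace[_ ID IZ] -> Ia Ib; apply: ID => //; apply: IZ.
Qed.

Section InIdeal.
Variable B : set A.
Hypothesis hB : is_ideal [set: A] B.

Let Bstar x : B x -> B (cstar x). Proof. exact: ideal_starT. Qed.

Lemma max_ideal M : Max B M -> is_ideal [set: A] M.
Proof. by case=> hM _ _ _; apply: ideal_trans hM. Qed.

Lemma max_sub M : Max B M -> M `<=` B.
Proof. by case=> -[]. Qed.

Lemma max_annihilator M x : Max B M -> B x -> (forall y, B y -> M (x ** y)) -> M x.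
Proof.
move=> MM Bx xM; have hM := max_ideal MM; apply: (qnorm_eq0 hM); apply/eqP.
by rewrite -sqrf_eq0 -qnorm_sqr// (qnorm_mem hM)//; apply/xM/Bstar.
Qed.

Lemma exists_max I d : is_ideal [set: A] I -> I `<=` B -> B d ->
  central_mod I d -> ~ I d -> exists M, [/\ Max B M, I `<=` M & ~ M d].
Proof.
move=> hI IB Bd cd Id; have [a [b [sa sb dab Hab]]] := real_imaginary d.
have [Ba Bb] := Hab _ (ideal_subspace hB) Bd (Bstar Bd).
have [sC _ _] := central_mod_subalgebra hI.
have [ca cb] := Hab _ sC cd (central_mod_star hI cd).
have half f : B f -> cstar f = f -> central_mod I f -> ~ I f ->
    (forall M, is_ideal [set: A] M -> M d -> M f) ->
    exists M, [/\ Max B M, I `<=` M & ~ M d].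
  move=> Bf sf cf If Mf.
  have [M [l [MM IM _ nMf _]]] := exists_character hB hI IB Bf sf cf If.
  by exists M; split=> // Md; apply: nMf; apply: Mf => //; apply: max_ideal.
have from M : is_ideal [set: A] M -> M d -> M a /\ M b.
  by move=> hM Md; apply: Hab => //; [exact: ideal_subspace hM|exact: ideal_starT].
have [Ia|Ia] := pselect (I a); last first.
  by apply: (half a) => // M hM Md; have [] := from M hM Md.
apply: (half b) => // [Ib|M hM Md]; last by have [] := from M hM Md.
by apply: Id; apply: ideal_real_imaginary dab Ia Ib.
Qed.

(** For a self-adjoint element outside [M], [exists_character] returns a maximal ideal containing
    [M], which is [M] itself; inside [M] the scalar is zero. *)
Lemma max_scalar M c : Max B M -> B c -> central_mod M c ->
  exists l, forall x, B x -> M (c ** x - l *: x).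
Proof.
move=> MM Bc cc; have hM := max_ideal MM; have MB := max_sub MM.
have [M0 MD MZ] := ideal_subspace hM.
have sa f : B f -> cstar f = f -> central_mod M f ->
    exists l, forall x, B x -> M (f ** x - l *: x).
  move=> Bf sf cf; have [Mf|Mf] := pselect (M f).
    by exists 0 => x Bx; rewrite scale0r subr0; apply: idealMr.
  have [M1 [l [MM1 MM1' _ _ fl]]] := exists_character hB hM MB Bf sf cf Mf.
  exists l; have [_ _ _ maxM] := MM; have [hM1 _ M1B _] := MM1.
  by have [<-|] := maxM M1 hM1 MM1'.
have [a [b [sa' sb cab Hab]]] := real_imaginary c.
have [Ba Bb] := Hab _ (ideal_subspace hB) Bc (Bstar Bc).
have [sC _ _] := central_mod_subalgebra hM.
have [ca cb] := Hab _ sC cc (central_mod_star hM cc).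
have [l Hl] := sa a Ba sa' ca; have [mu Hmu] := sa b Bb sb cb.
exists (l + 'i%C * mu) => x Bx.
have -> : c ** x - (l + 'i%C * mu) *: x =
    (a ** x - l *: x) + 'i%C *: (b ** x - mu *: x).
  by rewrite cab cmulDl cmulZl; lmod R[i].
by apply: (MD); [exact: Hl|apply: (MZ); exact: Hmu].
Qed.

Lemma nrm_unitary v : unitary v -> nrm v <= 2.
Proof.
move=> [/eqP + _]; rewrite addrC addr_eq0 => /eqP e.
have : nrm v ^+ 2 <= 2 * nrm v.
  by rewrite -nrm_sqr' e nrmN (le_trans (nrmD _ _))// nrm_star; lra.
by have := nrm_ge0 v; nra.
Qed.

(** The new unitary is the square of [1 + v]. *)
Lemma unitary_double v : unitary v -> unitary (2 *: v + v ** v).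
Proof.
have half (w : A) : unitary w -> (2 *: w + w ** w) + cstar (2 *: w + w ** w) +
    (2 *: w + w ** w) ** cstar (2 *: w + w ** w) = 0.
  move=> [/eqP + _]; rewrite addrC addr_eq0 => /eqP e.
  have two : Num.conj (2 : R[i]) = 2 by rewrite conjC_nat.
  rewrite cstarD cstarM cstarZ two; set s := cstar w in e *.
  have e1 : w ** (s ** s) = w + s - s ** s.
    by rewrite cmulA e cmulNl cmulDl e; lmod R[i].
  have e2 : w ** w ** s = w + s - w ** w.
    by rewrite -cmulA e cmulNr cmulDr e; lmod R[i].
  have e3 : w ** w ** (s ** s) = w ** w - 2 *: (w + s) + s ** s.
    by rewrite cmulA e2 cmulBl cmulDl e e2; lmod R[i].
  rewrite cmulDl !cmulDr !cmulZl !cmulZr e e1 e2 e3; lmod R[i].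
move=> uv; split; first exact: half.
have := half _ (unitary_star uv).
have two : Num.conj (2 : R[i]) = 2 by rewrite conjC_nat.
rewrite !(cstarD, cstarM, cstarZ) two cstarK.
by rewrite [X in X + _ ** _]addrC.
Qed.

Lemma cayley_mem S : is_ideal [set: A] S ->
  forall h v, v = (2 * 'i%C) *: h + 'i%C *: (h ** v) -> S v -> S h.
Proof.
move=> hS h v ev Sv; have [_ SD SZ] := ideal_subspace hS.
have i2 : (2 * 'i%C) != 0 :> R[i].
  by rewrite mulf_neq0 ?pnatr_eq0// eq_complex/= oner_eq0 andbF.
have e : v - 'i%C *: (h ** v) = (2 * 'i%C) *: h by rewrite {1}ev addrK.
have : S ((2 * 'i%C) *: h).
  rewrite -e; apply: subspaceB; [exact: ideal_subspace hS|by []|apply: (SZ)].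
  exact: idealMl.
by move=> /(SZ (2 * 'i%C)^-1); rewrite scalerA mulVf// scale1r.
Qed.

(** The Cayley transform of the scaled real or imaginary part of [z], whichever is outside [M]. By
    the last clause [v] separates ideals as [z] does. *)
Lemma central_unitary M z : is_ideal [set: A] M -> centre B z -> ~ M z ->
  exists v, [/\ unitary v, centre B v, ~ M v &
    forall N, is_ideal [set: A] N -> N z -> N v].
Proof.
move=> hM Zz Mz; have [a [b [sa sb zab Hab]]] := real_imaginary z.
have sZ := centre_subalgebra hB; have [subZ _ _] := sZ.
have [Za Zb] := Hab _ subZ Zz (centre_star hB Zz).
have half f : centre B f -> cstar f = f -> ~ M f ->
    (forall N, is_ideal [set: A] N -> N z -> N f) ->
    exists v, [/\ unitary v, centre B v, ~ M v &
      forall N, is_ideal [set: A] N -> N z -> N v].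
  move=> Zf sf Mf Nf; have [t t0 tf] := scale_lt1 f.
  have tC : t%:C%C != 0 :> R[i] by rewrite eq_complex/= eqxx andbT gt_eqF.
  have [|v [uv ev _ Sv]] := @cayley _ _ (t%:C%C *: f) _ tf.
    by rewrite cstarZ sf; congr (_ *: _); exact: conjc_real.
  exists v; split=> //.
  - by apply: Sv => //; have [_ _ ZZ] := subZ; apply: ZZ.
  - move=> /(cayley_mem hM ev) Mtf; apply: Mf.
    have [_ _ MZ] := ideal_subspace hM.
    by have := MZ (t%:C%C)^-1 _ Mtf; rewrite scalerA mulVf// scale1r.
  - move=> N hN Nz; apply: Sv; first exact: ideal_subalgebra hN.
    by have [_ _ NZ] := ideal_subspace hN; apply: (NZ); apply: Nf.
have from N : is_ideal [set: A] N -> N z -> N a /\ N b.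
  by move=> hN Nz; apply: Hab => //; [exact: ideal_subspace hN|exact: ideal_starT].
have [Ma|Ma] := pselect (M a); last first.
  by apply: (half a) => // N hN Nz; have [] := from N hN Nz.
apply: (half b) => // [Mb|N hN Nz]; last by have [] := from N hN Nz.
by apply: Mz; apply: ideal_real_imaginary zab Ma Mb.
Qed.

(* Doubling the argument of a scalar [1 + mu] of modulus one, other than [1],
   eventually moves it at distance at least one from [1]. *)
Lemma central_large_scalar M : Max B M -> ~ (centre B `<=` M) ->
  exists w mu, [/\ centre B w, nrm w <= 2, 1 <= nrm mu &
    forall x, B x -> M (w ** x - mu *: x)].
Proof.
move=> MM /existsNP[z /not_implyP[Zz Mz]]; have hM := max_ideal MM.
have [M0 MD MZ] := ideal_subspace hM.
have [subZ _ ZM] := centre_subalgebra hB; have [_ ZD ZZ] := subZ.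
have [v0 [uv0 Zv0 Mv0 _]] := central_unitary hM Zz Mz.
have cM w : centre B w -> central_mod M w.
  by move=> Zw y; rewrite (centre_ideal y hB Zw) subrr.
pose P v mu := [/\ unitary v, centre B v, mu != 0, nrm (1 + mu) = 1 &
  forall x, B x -> M (v ** x - mu *: x)].
have [mu0 Hmu0] := max_scalar MM Zv0.1 (cM _ Zv0).
have P0 : P v0 mu0.
  split=> //.
    apply/eqP => e; apply: Mv0; apply: (max_annihilator MM Zv0.1) => y By.
    by have := Hmu0 y By; rewrite e scale0r subr0.
  have qv : 0 < qnorm M v0 by apply: qnorm_gt0.
  apply: (mulIf (lt0r_neq0 qv)); rewrite mul1r -qnormZ//.
  rewrite -[RHS](qnorm_act hM _ uv0); apply: qnorm_congr => //.
  have -> : (1 + mu0) *: v0 - act v0 v0 = - (v0 ** v0 - mu0 *: v0).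
    by rewrite /act; lmod R[i].
  by apply: subspaceN; [exact: ideal_subspace hM|apply/Hmu0; case: Zv0].
have step v mu : P v mu -> nrm mu < 1 ->
    exists v' mu', P v' mu' /\ 3 * nrm mu ^+ 2 <= nrm mu' ^+ 2.
  move=> [uv Zv mu_neq0 mu1 Hmu] mu_lt1.
  (* Parallelogram law for [1 + mu] and [1]. Squaring the unitary sends [mu] to [mu (2 + mu)], whose
     squared modulus is thus at least three times that of [mu] while [nrm mu < 1]. *)
  have par : nrm (2 + mu) ^+ 2 = 4 - nrm mu ^+ 2.
    have : (nrm (2 + mu) ^+ 2 + nrm mu ^+ 2)%:C%C = (2 * (nrm (1 + mu) ^+ 2 + 1))%:C%C.
      have c1 : Num.conj (1 + mu) = 1 + Num.conj mu by rewrite rmorphD/= conjC1.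
      have c2 : Num.conj (2 + mu) = 2 + Num.conj mu by rewrite rmorphD/= conjC_nat.
      rewrite rmorphM/= rmorph_nat [LHS]rmorphD [in RHS]rmorphD/= -!cabs_sqr c1 c2.
      by rewrite rmorph1; ring.
    by move=> /(@complexI R); rewrite mu1; lra.
  exists (2 *: v + v ** v), (mu * (2 + mu)); split; last first.
    have s1 : nrm mu ^+ 2 <= 1 by rewrite exprn_ile1 ?nrm_ge0// ltW.
    have := exprn_ge0 2 (nrm_ge0 mu); rewrite cabsM exprMn par; nra.
  split.
  - exact: unitary_double.
  - by apply: (ZD); [exact: ZZ|exact: ZM].
  - rewrite mulf_neq0//; apply/eqP => e; move: par; rewrite e nrm0 expr0n/=.
    by have := exprn_ile1 2 (nrm_ge0 mu) (ltW mu_lt1); lra.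
  - have -> : 1 + mu * (2 + mu) = (1 + mu) * (1 + mu) by ring.
    by rewrite cabsM mu1 mulr1.
  - move=> x Bx.
    have -> : (2 *: v + v ** v) ** x - (mu * (2 + mu)) *: x =
       v ** (v ** x - mu *: x) + (2 + mu) *: (v ** x - mu *: x).
      by rewrite cmulDl cmulZl cmulBr cmulZr cmulA; lmod R[i].
    by apply: (MD); [apply: idealMl => //|apply: (MZ)]; exact: Hmu.
have iter n : exists v mu, P v mu /\
    (1 <= nrm mu \/ 3 ^+ n * nrm mu0 ^+ 2 <= nrm mu ^+ 2).
  elim: n => [|n [v [mu [Pv [mu1|IH]]]]].
  - by exists v0, mu0; split=> //; right; rewrite expr0 mul1r.
  - by exists v, mu; split=> //; left.
  have [mu1|mu1] := leP 1 (nrm mu); first by exists v, mu; split=> //; left.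
  have [v' [mu' [Pv' H]]] := step v mu Pv mu1.
  exists v', mu'; split=> //; right.
  by rewrite exprS -mulrA (le_trans _ H)// ler_pM2l.
have r0 : 0 < nrm mu0 ^+ 2.
  have [_ _ mu_neq0 _ _] := P0; apply: exprn_gt0.
  by rewrite lt_neqAle nrm_ge0 andbT eq_sym; apply: contra_neq mu_neq0 => /nrm0_eq0.
pose n := Num.bound (nrm mu0 ^+ 2)^-1.
have [v [mu [[uv Zv _ _ Hmu] Hn]]] := iter n.
have big : 1 <= nrm mu.
  case: Hn => // Hn; rewrite -(@ler_pXn2r _ 2) ?nnegrE ?nrm_ge0//.
  rewrite expr1n (le_trans _ Hn)// -ler_pdivrMr// mul1r.
  apply: le_trans (_ : n%:R <= _); first by rewrite ltW// archi_boundP// invr_ge0 ltW.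
  by rewrite -natrX ler_nat ltnW// ltn_expl.
by exists v, mu; split=> //; apply: nrm_unitary.
Qed.

Lemma centre_act v x : centre B v -> centre B x -> centre B (act v x).
Proof.
move=> Zv Zx; have [[_ ZD _] _ ZM] := centre_subalgebra hB.
by apply: (ZD) => //; apply: ZM.
Qed.

(* At each [t] the maximality of [I] provides an approximation of [c] modulo
   [I] and [(1 + v) - expi t], where [1 + v] is a central unitary equal to [1]
   modulo [M1] but not modulo [M2]; [patch] glues them. *)
Lemma no_separation c (C e : R) I M1 M2 h : 0 <= C ->
  is_ideal [set: A] I -> I `<=` B ->
  (forall z, centre B z -> nrm z <= C -> e <= qnorm I (c - z)) ->
  (forall L, is_ideal [set: A] L -> I `<=` L -> L `<=` B ->
     (forall z, centre B z -> nrm z <= C -> e <= qnorm L (c - z)) -> L = I) ->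
  Max B M1 -> Max B M2 -> I `<=` M1 -> I `<=` M2 -> centre B h -> M1 h -> ~ M2 h ->
  False.
Proof.
move=> C0 hI IB eI maxI MM1 MM2 IM1 IM2 Zh M1h M2h.
have hM1 := max_ideal MM1; have hM2 := max_ideal MM2.
have [v [uv Zv M2v Nv]] := central_unitary hM2 Zh M2h.
have M1v := Nv _ hM1 M1h.
have vC x : v ** x - x ** v = 0 by rewrite (centre_ideal x hB Zv) subrr.
have [I0 ID IZ] := ideal_subspace hI.
have cv : central_mod I v by move=> x; rewrite vC.
have loc t : exists s x, [set z | centre B z /\ nrm z <= C] s /\
    qnorm I (c - s - (act v x - expi t *: x)) < e.
  set zt := expi t; apply: contrapT => /forallNP nex.
  have aS : algebraic_ideal (spectral B I v zt) by apply: spectral_ideal.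
  have SI : adherent (spectral B I v zt) = I.
    apply: maxI.
    - exact: adherent_ideal.
    - exact: sub_spectral.
    - by apply: spectral_sub => //; case: Zv.
    move=> z Zz zC; apply: qnorm_adherent => // _ [y [x [Iy Bx ->]]].
    have /forallNP/(_ x)/not_andP[/(_ (conj Zz zC))//|/negP] := nex z.
    rewrite -leNgt => H; apply: le_trans H _; rewrite -/zt.
    have -> : c - z - (y + (act v x - zt *: x)) =
        c - z - (act v x - zt *: x) - y by lmod R[i].
    exact: qnorm_lb.
  have IT x : B x -> I (act v x - zt *: x) by move=> Bx; rewrite -SI; apply: spectral_mem.
  have [M10 M1D M1Z] := ideal_subspace hM1.
  (* On [B], [1 + v] now acts as the scalar [zt] modulo [I]. Since [v] is in [M1], this scalar is
     [1], and then [v] falls into [M2]. *)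
  have z1 : zt = 1.
    apply/eqP; rewrite -subr_eq0; apply/negP => /negP z1.
    have [_ _ + _] := MM1; apply; apply/seteqP; split=> [|x Bx]; first exact: max_sub.
    have : M1 ((zt - 1) *: x).
      have -> : (zt - 1) *: x = v ** x - (act v x - zt *: x) by rewrite /act; lmod R[i].
      apply: subspaceB; [exact: ideal_subspace hM1|exact: idealMr|].
      by apply: IM1; apply: IT.
    by move=> /(M1Z (zt - 1)^-1); rewrite scalerA mulVf// scale1r.
  apply: M2v; apply: (max_annihilator MM2 Zv.1) => y By; apply: IM2.
  have := IT y By; rewrite z1 scale1r (_ : _ - _ = v ** y)//.
  by rewrite /act; lmod R[i].
have [n [N [g [s [gN g1 Ss dist]]]]] := patch hI uv cv loc.
set w := \sum_(i < n) _ in dist.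
have [subZ _ ZM] := centre_subalgebra hB; have [Z0 ZD ZZ] := subZ.
have Ziter k x : centre B x -> centre B (iter k (act v) x).
  by move=> Zx; elim: k => //= k IH; apply: centre_act.
have Zw : centre B w.
  apply: subspace_sum => // i _; apply: subspace_sum => // k _; apply: (ZZ).
  by apply: Ziter; case: (Ss i).
(* [v] commutes with all of [A], so the gluing estimate also holds modulo the zero ideal, where it
   bounds the norm itself. *)
have wC : nrm w <= C.
  rewrite -qnorm_zero; apply: pact_bound => //; first exact: zero_ideal.
  by move=> i; rewrite qnorm_zero; case: (Ss i).
have Zsv := centre_star hB Zv.
have usv := unitary_star uv.
(* [patch] approximates [c] times a power of the unitary; the inverse power undoes this and keeps
   [w] central and of the same norm. *)
pose z := iter n.-1 (act (cstar v)) w.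
have Zz : centre B z.
  by rewrite /z; elim: (n.-1) => //= k IH; apply: centre_act.
have zC : nrm z <= C by rewrite nrm_iter_act.
have wz : iter n.-1 (act v) z = w.
  by rewrite /z; elim: (n.-1) => // k IH; rewrite iterSr [iter k.+1 _ w]iterS act_starK.
have := eI z Zz zC; rewrite leNgt => /negP; apply.
by rewrite -(qnorm_iter_act hI n.-1 _ uv) iter_actB wz.
Qed.

Hypothesis wc : weakly_central B.

Lemma centre_approximation K c e : is_ideal [set: A] K -> K `<=` B -> B c ->
  central_mod K c -> 0 < e ->
  exists z y, [/\ centre B z, nrm z <= 2 * nrm c, K y & nrm (c - z - y) < e].
Proof.
move=> hK KB Bc cc e0; apply: contrapT => bad.
have C0 : 0 <= 2 * nrm c by rewrite mulr_ge0// nrm_ge0.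
pose F := [set f | exists z, [/\ centre B z, nrm z <= 2 * nrm c & f = c - z]].
have [|I [hI KI IB eI maxI]] := @maximal_ideal _ _ B K F e hB hK KB.
  move=> _ [z [Zz zc ->]]; rewrite leNgt; apply/negP => /(qnorm_lt hK)[y Ky H].
  by apply: bad; exists z, y.
have [subZ _ _] := centre_subalgebra hB; have [Z0 ZD ZZ] := subZ.
have {}eI z : centre B z -> nrm z <= 2 * nrm c -> e <= qnorm I (c - z).
  by move=> Zz zc; apply: eI; exists z.
have Ic : ~ I c.
  move=> Ic; have := eI 0 Z0; rewrite nrm0 subr0 (qnorm_mem hI Ic) => /(_ C0).
  lra.
have cI := central_mod_subset KI cc.
have [M [MM IM Mc]] := exists_max hI IB Bc cI Ic.
have hM := max_ideal MM; have [M0 MD MZ] := ideal_subspace hM.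
have [l Hl] := max_scalar MM Bc (central_mod_subset IM cI).
have lc : nrm l <= nrm c.
  have qc : 0 < qnorm M c by apply: qnorm_gt0.
  rewrite -(ler_pM2r qc) -qnormZ//.
  have -> : qnorm M (l *: c) = qnorm M (c ** c).
    by apply: qnorm_congr => //; rewrite -opprB; apply: subspaceN; [exact: ideal_subspace hM|exact: Hl].
  by rewrite (le_trans (qnormM hM _ _))// ler_wpM2r ?qnorm_le_nrm// ltW.
have [w [mu [Zw w2 mu1 Hw]]] := central_large_scalar MM (wc.1 M MM).
have mu0 : mu != 0 by apply/eqP => e1; move: mu1; rewrite e1 nrm0; lra.
(* Origin of the bound [2 * nrm c]: [nrm l <= nrm c], [1 <= nrm mu] and [nrm w <= 2]. *)
pose z := (l / mu) *: w.
have Zz : centre B z by apply: ZZ.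
have zc : nrm z <= 2 * nrm c.
  rewrite nrmZ cabsM cabsV.
  have : nrm l / nrm mu <= nrm c.
    rewrite (le_trans _ lc)// ler_pdivrMr ?(lt_le_trans _ mu1)//.
    by rewrite ler_peMr// nrm_ge0.
  have : 0 <= nrm l / nrm mu by rewrite divr_ge0// nrm_ge0.
  have := nrm_ge0 w; have := nrm_ge0 c; nra.
have Bd : B (c - z) by apply: subspaceB => //; [exact: ideal_subspace hB|case: Zz].
have Md : M (c - z).
  apply: (max_annihilator MM Bd) => y By.
  have -> : (c - z) ** y = (c ** y - l *: y) - (l / mu) *: (w ** y - mu *: y).
    have -> : (c - z) ** y = c ** y - (l / mu) *: (w ** y) by rewrite /z cmulBl cmulZl.
    rewrite scalerBr scalerA divfK//; lmod R[i].
  by apply: subspaceB; [exact: ideal_subspace hM|exact: Hl|apply: (MZ); exact: Hw].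
have Id : ~ I (c - z).
  by move=> Id; have := eI z Zz zc; rewrite (qnorm_mem hI Id); lra.
have cd : central_mod I (c - z).
  move=> y; rewrite cmulBl cmulBr (centre_ideal y hB Zz) opprB addrA subrK.
  exact: cI.
have [M' [MM' IM' M'd]] := exists_max hI IB Bd cd Id.
have {}maxI L : is_ideal [set: A] L -> I `<=` L -> L `<=` B ->
     (forall z, centre B z -> nrm z <= 2 * nrm c -> e <= qnorm L (c - z)) -> L = I.
  by move=> hL IL LB eL; apply: maxI => // _ [u [Zu uc ->]]; apply: eL.
have [/wc.2 H|sep] := pselect (M `&` centre B = M' `&` centre B).
  by apply: M'd; rewrite -(H MM MM').
apply: sep; apply/seteqP; split=> h [Mh Zh]; split=> //; apply: contrapT => nh.
  exact: (no_separation C0 hI IB eI maxI MM MM' IM IM' Zh Mh nh).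
exact: (no_separation C0 hI IB eI maxI MM' MM IM' IM Zh Mh nh).
Qed.

Lemma weakly_central_lift K c : is_ideal [set: A] K -> K `<=` B -> B c ->
  central_mod K c -> exists2 z, centre B z & K (c - z).
Proof.
move=> hK KB Bc cc; have [K0 KD KZ] := ideal_subspace hK.
have sZ := centre_subalgebra hB; have [subZ _ _] := sZ; have [Z0 ZD ZZ] := subZ.
have /choice[f Hf] : forall x, exists p : A * A, B x /\ central_mod K x ->
    [/\ centre B p.1, nrm p.1 <= 2 * nrm x, K p.2 & nrm (x - p.1 - p.2) <= nrm x / 2].
  (* The pair [(0, 0)] is a placeholder outside the domain, and the exact answer at [x = 0], where
     [nrm x / 2] is no positive tolerance. *)
  move=> x; have [[Bx cx]|nx] := pselect (B x /\ central_mod K x); last by exists (0, 0).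
  have [x0|x0] := eqVneq (nrm x) 0.
    by exists (0, 0); rewrite (nrm0_eq0 x0) !subr0 nrm0 mulr0 mul0r.
  have [|z [y [Zz zx Ky xy]]] := @centre_approximation K x (nrm x / 2) hK KB Bx cx.
    by rewrite divr_gt0// lt_neqAle eq_sym x0 nrm_ge0.
  by exists (z, y) => _; split=> //; apply: ltW.
pose r n := iter n (fun x => x - (f x).1 - (f x).2) c.
have inv n : B (r n) /\ central_mod K (r n).
  elim: n => // n [IB IC]; have [[Bz zB] _ Ky _] := Hf _ (conj IB IC).
  have Zz : centre B (f (r n)).1 by [].
  have By := KB _ Ky; have sB := ideal_subspace hB.
  split; first by apply: subspaceB => //; apply: subspaceB.
  have [sC _ _] := central_mod_subalgebra hK.
  apply: (subspaceB sC); first apply: (subspaceB sC) => //.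
    by move=> x; rewrite (centre_ideal x hB Zz) subrr.
  by move=> x; apply: subspaceB; [exact: ideal_subspace hK|exact: idealMr|exact: idealMl].
have rn n : nrm (r n) <= nrm c * 2^-1 ^+ n.
  elim: n => [|n IH]; first by rewrite expr0 mulr1.
  have [_ _ _ H] := Hf _ (inv n); rewrite (le_trans H)// exprSr mulrA.
  by rewrite ler_wpM2r.
pose u n := \sum_(i < n) (f (r i)).1.
have Zu n : centre B (u n).
  by apply: subspace_sum => // i _; have [] := Hf _ (inv i).
have [||z Hz] := @cauchy_geometric _ _ u (2 * nrm c) 2^-1.
- by rewrite invr_ge0 ler0n invf_lt1// ltr1n.
- move=> n; rewrite /u big_ord_recr/= addrAC subrr add0r.
  have [_ H _ _] := Hf _ (inv n); rewrite (le_trans H)// -mulrA ler_wpM2l//.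
have Zz : centre B z.
  have [_ /closed_adherent cZ _] := sZ; apply: cZ => e /Hz[N HN].
  by exists (u N) => //; apply: HN.
exists z => //; apply: (ideal_adherent hK) => e e0; have e2 : 0 < e / 2 by lra.
have [N HN] := Hz _ e2.
have Ku n : K (c - r n - u n).
  elim: n => [|n IH]; first by rewrite /u big_ord0 subr0 subrr.
  have [_ _ Ky _] := Hf _ (inv n).
  have -> : c - r n.+1 - u n.+1 = (c - r n - u n) + (f (r n)).2.
    have -> : u n.+1 = u n + (f (r n)).1 by rewrite /u big_ord_recr.
    have -> : r n.+1 = r n - (f (r n)).1 - (f (r n)).2 by [].
    by lmod R[i].
  exact: KD.
have [n [Nn rsmall]] : exists n, (N <= n)%N /\ nrm (r n) < e / 2.
  have c1 : 0 < nrm c + 1 by rewrite ltr_wpDl// nrm_ge0.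
  have /cvgrPdist_lt /(_ _ (divr_gt0 e2 c1)) : 2^-1 ^+ n @[n --> \oo] --> (0 : R).
    by apply: cvg_expr; rewrite ger0_norm// invf_lt1// ltr1n.
  case=> n0 _ Hn0; exists (maxn N n0); split; first exact: leq_maxl.
  have := Hn0 (maxn N n0) (leq_maxr _ _) => /=.
  rewrite sub0r normrN ger0_norm ?exprn_ge0// ltr_pdivlMr// => H.
  rewrite (le_lt_trans (rn _))//; apply: le_lt_trans H.
  by rewrite mulrC ler_wpM2l ?exprn_ge0// lerDl.
exists (c - r n - u n); first exact: Ku.
have -> : c - z - (c - r n - u n) = r n - (z - u n) by lmod R[i].
by rewrite (le_lt_trans (nrmB _ _))//; have := HN n Nn; lra.
Qed.

End InIdeal.

End WeaklyCentral.

(** * Reduction to the lifting of central elements *)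

Theorem corollary4p4 (R : realType) (A : cstarAlgType R) (J : set A)
    (hJ : is_Jwc J) :
  [set z + j | z in centre [set: A] & j in J] `<=` CQ [set: A].
Proof.
have [[idJ wcJ] _] := hJ.
move=> _ [z [_ zC] [j Jj <-]]; split=> // I hI [_ comm].
have zjI : central_mod I (z + j).
  move=> x; have := comm (coset I x); rewrite !quot_mul_coset// => e.
  have : coset I ((z + j) ** x) ((z + j) ** x).
    by rewrite /coset/= subrr; have [] := ideal_subspace hI.
  by rewrite e//; exists x.
have jI : central_mod I j.
  by move=> x; have := zjI x; rewrite cmulDl cmulDr zC// opprD addrACA subrr add0r.
(* The commutators of [j] lie in [J] as well as in [I]; lifting modulo [K] keeps the problem inside
   [J]. *)
pose K := I `&` J.
have hK : is_ideal [set: A] K.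
  split=> //.
  - apply/submod_closedP; have [I0 ID IZ] := ideal_subspace hI.
    have [J0 JD JZ] := ideal_subspace idJ.
    by split=> // [x y [? ?] [? ?]|c x [? ?]]; split; [exact: ID|exact: JD|exact: IZ|exact: JZ].
  - by apply: closedI; [case: hI|case: idJ].
  - move=> b x _ [Ix Jx].
    by split; split; [exact: idealMl|exact: idealMl|exact: idealMr|exact: idealMr].
have jK : central_mod K j.
  move=> x; split; first exact: jI.
  by apply: subspaceB; [exact: ideal_subspace idJ|exact: idealMr|exact: idealMl].
have [w Zw [Ijw _]] := weakly_central_lift idJ wcJ hK (@subIsetr _ _ _) Jj jK.
exists (z + w).
  split=> // b _; rewrite cmulDl cmulDr zC//.
  by rewrite (centre_ideal b idJ Zw).
by exists (j - w) => //; rewrite addrACA subrr addr0.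
Qed.
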